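(* Let $M=(a,b)\times N$ carry the metrics $g=dr^2+G(r)$ and $g_0=dr^2+\mathring{h}^2(r)\hat G$ described in the context, and let $\mathcal M(r)$ be the relative radial mass of $g$ with respect to $g_0$. Suppose that the limits $\mathcal M(a):=\lim_{r\to a}\mathcal M(r)$ and $\mathcal M(b):=\lim_{r\to b}\mathcal M(r)$ exist (as real numbers), that $\mathring{h}^{2}(R_{rr}-\mathring{R}_{rr})\in L^1(M,dr\,d\mu_{\hat G})$, and that $$\int_M\mathring{h}^{2}(R_{rr}-\mathring{R}_{rr})\,dr\,d\mu_{\hat{G}}\geq 0.$$ Then $\mathcal M(b)\geq\mathcal M(a)$, with equality if and only if $G(r)=\mathring{h}^2(r)\widetilde{G}$ for all $r\in(a,b)$, for some fixed (independent of $r$) Riemannian metric $\widetilde{G}$ on $N$. If furthermore $g$ is asymptotic to $g_0$ at some $r_0\in[a,b]$, then equality holds if and only if $g=g_0$.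
   Context: Let $n\geq 2$, let $N$ be a compact $(n-1)$-dimensional smooth manifold (with or without boundary), let $(a,b)$ be an open interval of $\mathbb R$ (possibly unbounded), and $M=(a,b)\times N$, with $r$ the coordinate on $(a,b)$. All objects are assumed $C^\infty$. Let $g=dr^2+G(r)$ be a Riemannian metric on $M$, where $G(r)$ is a family of Riemannian metrics on $N$. Let $g_0=dr^2+\mathring{G}(r)$ with $\mathring{G}(r)=\mathring{h}^2(r)\hat{G}$, where $\mathring{h}$ is a positive function on $(a,b)$ and $\hat{G}$ is a fixed Riemannian metric on $N$, with Riemannian measure $\mu_{\hat G}$. Let $N(r)=\{r\}\times N$, and let $H$ and $\mathring H$ be the mean curvatures (traces of the Weingarten maps with respect to $\partial_r$) of $N(r)$ relative to $g$ and $g_0$: $H=\frac12\operatorname{Tr}(G^{-1}\partial_rG)$ and $\mathring H=(n-1)\mathring h'/\mathring h$. The radial mass at $(r,x)\in M$ is $m(r,x)=\mathring{h}^{2}(\mathring{H}-H)$, and the relative radial mass on $N(r)$ is $\mathcal M(r)=\int_N m(r,x)\,d\mu_{\hat G}(x)$. $R_{rr}$ and $\mathring R_{rr}=-(n-1)\mathring h''/\mathring h$ denote the Ricci curvatures in the $(\partial_r,\partial_r)$ direction of $g$ and $g_0$ respectively. $g$ is said to be asymptotic to $g_0$ at $r_0\in[a,b]$ if $\|G-\mathring G\|_{\mathring G}=o(1)$ as $r\to r_0$, uniformly on $N$ (pointwise norm of tensors on $N$ with respect to $\mathring G(r)$); for $r_0\in(a,b)$ this means that the two metrics coincide on $N(r_0)$.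 *)

(* Defs.v *)
From HB Require Import structures.
From mathcomp Require Import all_boot all_order all_algebra.
From mathcomp Require Import all_classical all_reals all_analysis.
Set Implicit Arguments.
Unset Strict Implicit.
Unset Printing Implicit Defensive.
Import Order.TTheory GRing.Theory Num.Theory numFieldNormedType.Exports.
Local Open Scope classical_set_scope.
Local Open Scope ring_scope.

Section Calculus.
Context {R : realType}.

Definition basis_vec {m : nat} (i : 'I_m) : 'rV[R]_m := delta_mx ord0 i.

(* f is C^k on the open set V: all iterated partial derivatives of order at
   most k exist and are continuous on V. *)
Fixpoint Ck_on {m : nat} (k : nat) (V : set 'rV[R]_m) (f : 'rV[R]_m -> R) :
    Prop :=
  (forall x, V x -> {for x, continuous f}) /\
  if k is k'.+1 then
    forall i : 'I_m, (forall x, V x -> derivable f x (basis_vec i)) /\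
      Ck_on k' V (fun x => 'D_(basis_vec i) f x)
  else True.

(* For a set A which need not be open (a relatively open subset of a
   half-space), f is smooth on A if near each point of A it extends to a
   C^oo function on an open set. *)
Definition smooth_on {m : nat} (A : set 'rV[R]_m) (f : 'rV[R]_m -> R) : Prop :=
  forall x, A x -> exists V : set 'rV[R]_m, exists F : 'rV[R]_m -> R,
    [/\ open V, V x, forall k, Ck_on k V F
      & forall y, A y -> V y -> F y = f y].

(* Partial derivative relative to A: only increments staying in A are used, so
   that it is one-sided in the direction transverse to the boundary of a
   half-space, and does not depend on the values of f outside A. *)
Definition partial {m : nat} (A : set 'rV[R]_m) (i : 'I_m)
    (f : 'rV[R]_m -> R) (x : 'rV[R]_m) : R :=
  lim (t^-1 * (f (x + t *: basis_vec i) - f x)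
         @[t --> within [set t : R | A (x + t *: basis_vec i)] (0 : R)^']).

(* The Lebesgue integral over R^m of a nonnegative Borel function, as an
   iterated integral (Tonelli). *)
Fixpoint iterated_integral (m : nat) : ('rV[R]_m -> \bar R) -> \bar R :=
  match m return ('rV[R]_m -> \bar R) -> \bar R with
  | 0 => fun f => f 0
  | m'.+1 => fun f =>
      (\int[lebesgue_measure]_t
         iterated_integral (fun x : 'rV[R]_m' =>
           f (row_mx (t%:M : 'rV[R]_1) x)))%E
  end.

(* Coordinate formulas for a metric with Gram matrix g on A, a subset of R^m:
   Gamma^k_ij, where nabla_(d_i) d_j = Gamma^k_ij d_k, and Ric_jk, with the
   sign for which round spheres have positive Ricci curvature. *)
Definition christoffel {m : nat} (A : set 'rV[R]_m) (g : 'rV[R]_m -> 'M[R]_m)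
    (k i j : 'I_m) (x : 'rV[R]_m) : R :=
  2^-1 * \sum_l invmx (g x) k l *
    (partial A i (fun y => g y j l) x + partial A j (fun y => g y i l) x
     - partial A l (fun y => g y i j) x).

Definition ricci {m : nat} (A : set 'rV[R]_m) (g : 'rV[R]_m -> 'M[R]_m)
    (j k : 'I_m) (x : 'rV[R]_m) : R :=
  let Gamma := christoffel A g in
  \sum_i (partial A i (Gamma i j k) x - partial A j (Gamma i k i) x
          + \sum_p (Gamma i i p x * Gamma p j k x
                    - Gamma i j p x * Gamma p i k x)).

(* f is C^oo on the open interval of real numbers between a and b. *)
Definition smooth_on_itv (a b : \bar R) (f : R -> R) : Prop :=
  forall (k : nat) (r : R), (a < r%:E < b)%E -> derivable (derive1n k f) r 1.

(* The filter of neighbourhoods of r0 in the open interval (a, b), where r0 may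
   be any point of the closed interval [a, b] of the extended reals. *)
Definition nbhs_in (a b r0 : \bar R) : set_system R :=
  fine s @[s --> within [set s : \bar R | (a < s < b)%E] (nbhs r0)].

End Calculus.

Definition half_space (R : realType) (d : nat) : set 'rV[R]_d :=
  [set x | forall j : 'I_d, val j = 0%N -> 0 <= x ord0 j].

(* A smooth atlas of dimension d, with boundary allowed: charts are
   homeomorphisms from an open set of N onto a relatively open subset of the
   half-space, and changes of charts are smooth. The map [param c] inverts
   [coord c]; its values outside the image of the chart are irrelevant.  The
   chart [chart_at p] around p is where chart-independent quantities at p are
   evaluated. *)
Record smooth_structure (R : realType) (d : nat) (N : topologicalType) :=
  SmoothStructure {
    chart : Type;
    dom : chart -> set N;
    coord : chart -> N -> 'rV[R]_d;
    param : chart -> 'rV[R]_d -> N;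
    chart_at : N -> chart;
    dom_open : forall c, open (dom c);
    dom_chart_at : forall p, dom (chart_at p) p;
    coordK : forall c p, dom c p -> param c (coord c p) = p;
    coord_continuous : forall c p, dom c p -> {for p, continuous (coord c)};
    coord_open : forall c (U : set N), open U -> U `<=` dom c ->
      exists2 O : set 'rV[R]_d, open O & coord c @` U = O `&` @half_space R d;
    transition_smooth : forall c c' (j : 'I_d),
      smooth_on (coord c @` (dom c `&` dom c'))
                (fun x => coord c' (param c x) ord0 j)
  }.

Section Geometry.
Context {R : realType} {d : nat} {N : ptopologicalType}.
Variable S : smooth_structure R d N.

Definition chart_image (c : chart S) : set 'rV[R]_d := coord c @` dom c.

(* A covariant 2-tensor field on N, given by its matrix of components at each
   point with respect to each chart; only the values G c p with p in dom c are
   meaningful. *)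
Definition tensor2 := chart S -> N -> 'M[R]_d.

(* Row k, column l: the derivative at p of the l-th coordinate of c' with
   respect to the k-th coordinate of c. *)
Definition transition_jacobian (c c' : chart S) (p : N) : 'M[R]_d :=
  \matrix_(k, l) partial (coord c @` (dom c `&` dom c')) k
                   (fun x => coord c' (param c x) ord0 l) (coord c p).

Definition is_riemannian_metric (G : tensor2) : Prop :=
  [/\ forall c p, dom c p -> (G c p)^T = G c p,
      forall c p (v : 'rV[R]_d), dom c p -> v != 0 ->
        0 < (v *m G c p *m v^T) ord0 ord0,
      forall c c' p, dom c p -> dom c' p ->
        G c p = transition_jacobian c c' p *m G c' p
                *m (transition_jacobian c c' p)^T
    & forall c i j, smooth_on (chart_image c) (fun x => G c (param c x) i j)].

Definition is_riemannian_measure (G : tensor2)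
    (mu : set (g_sigma_algebraType (@open N)) -> \bar R) : Prop :=
  forall (c : chart S) (A : set (g_sigma_algebraType (@open N))),
    measurable A -> A `<=` dom c ->
    mu A = iterated_integral (fun x =>
      (\1_(coord c @` A) x * Num.sqrt (\det (G c (param c x))))%:E).

(* |T|_G^2 = G^ac G^bd T_ab T_cd at p. *)
Definition tensor_norm (G T : tensor2) (p : N) : R :=
  let c := chart_at S p in
  Num.sqrt (\tr (invmx (G c p) *m T c p *m invmx (G c p) *m (T c p)^T)).

Section Product.
Variables a b : \bar R.

(* M = (a, b) x N is covered by the charts (r, p) |-> (r, coord c p); the index
   of the coordinate r is [radial], those of the coordinates on N are the
   [rshift 1 u]. *)
Definition radial : 'I_(1 + d) := lshift d ord0.

Definition prod_coord (c : chart S) (r : R) (p : N) : 'rV[R]_(1 + d) :=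
  row_mx (r%:M : 'rV[R]_1) (coord c p).

Definition prod_image (c : chart S) : set 'rV[R]_(1 + d) :=
  [set z : 'rV[R]_(1 + d) | (a < (z ord0 radial)%:E < b)%E /\ chart_image c (rsubmx z)].

(* The metric dr^2 + G(r). *)
Definition prod_metric (G : R -> tensor2) (c : chart S) (z : 'rV[R]_(1 + d)) :
    'M[R]_(1 + d) :=
  block_mx (1%:M : 'M[R]_1) 0 0 (G (z ord0 radial) c (param c (rsubmx z))).

Definition is_metric_family (G : R -> tensor2) : Prop :=
  (forall r, (a < r%:E < b)%E -> is_riemannian_metric (G r)) /\
  (forall c i j, smooth_on (prod_image c) (fun z => prod_metric G c z i j)).

Definition warped (h : R -> R) (G : tensor2) : R -> tensor2 :=
  fun r c p => h r ^+ 2 *: G c p.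

Definition same_family (G G' : R -> tensor2) : Prop :=
  forall r c p, (a < r%:E < b)%E -> dom c p -> G r c p = G' r c p.

Definition same_metric (G G' : R -> tensor2) : Prop :=
  forall r c p, (a < r%:E < b)%E -> dom c p ->
    prod_metric G c (prod_coord c r p) = prod_metric G' c (prod_coord c r p).

(* The Weingarten map X |-> nabla_X d_r of N(r) in dr^2 + G(r). *)
Definition weingarten (G : R -> tensor2) (r : R) (p : N) : 'M[R]_d :=
  let c := chart_at S p in
  \matrix_(u, v) christoffel (prod_image c) (prod_metric G c)
                   (rshift 1 u) (rshift 1 v) radial (prod_coord c r p).

Definition mean_curvature (G : R -> tensor2) (r : R) (p : N) : R :=
  \tr (weingarten G r p).

Definition ricci_rr (G : R -> tensor2) (r : R) (p : N) : R :=
  let c := chart_at S p in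
  ricci (prod_image c) (prod_metric G c) radial radial (prod_coord c r p).

Definition radial_mass (h : R -> R) (Gh : tensor2) (G : R -> tensor2)
    (r : R) (p : N) : R :=
  h r ^+ 2 * (mean_curvature (warped h Gh) r p - mean_curvature G r p).

Definition relative_mass (h : R -> R) (Gh : tensor2) (G : R -> tensor2)
    (mu : {measure set (g_sigma_algebraType (@open N)) -> \bar R}) (r : R) : R :=
  \int[mu]_p radial_mass h Gh G r p.

Definition weighted_ricci_diff (h : R -> R) (Gh : tensor2) (G : R -> tensor2)
    (z : R * g_sigma_algebraType (@open N)) : R :=
  h z.1 ^+ 2 * (ricci_rr G z.1 z.2 - ricci_rr (warped h Gh) z.1 z.2).

Definition asymptotic_at (G G0 : R -> tensor2) (r0 : \bar R) : Prop :=
  forall e : R, 0 < e -> \forall r \near nbhs_in a b r0, forall p : N,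
    tensor_norm (G0 r) (fun c q => G r c q - G0 r c q) p < e.

End Product.
End Geometry.

(* Main.v *)
From Pilot Require Import Defs.
From HB Require Import structures.
From mathcomp Require Import all_boot all_order all_algebra.
From mathcomp Require Import all_classical all_reals all_analysis.
From mathcomp Require Import finmap perm ring lra measurable_realfun.
(* The definitions are imported again after the libraries, so that [coord] is the
   coordinate map of a chart and not a coordinate in a basis of a vector space. *)
Import Pilot.Defs.
Set Implicit Arguments.
Unset Strict Implicit.
Unset Printing Implicit Defensive.
Import Order.TTheory GRing.Theory Num.Theory numFieldNormedType.Exports.
Local Open Scope classical_set_scope.
Local Open Scope ring_scope.

(** Let W be the Weingarten map of the slice N(r), which in a chart of N is
    (1/2) G^-1 d_r G ([radial_shape]), let H = tr W, and let k = h'/h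
    ([log_derive]). Write d for the dimension of N.

    The trace of the Riccati equation W' + W^2 + R = 0 along the radial geodesics is
    R_rr = - H' - tr W^2 ([ricci_rrE]). For the warped metric h^2 Gh the slices are
    umbilical, W = k Id ([warped_shape]), whence R0_rr = - d (k' + k^2). Inserting
    both in the derivative of the radial mass m = h^2 (d k - H) gives

      d_r m = h^2 tr (W - k Id)^2 + h^2 (R_rr - R0_rr)

    ([is_derive_radial_mass]). The defect W - k Id is G^-1 B with B symmetric, so
    the trace of its square is nonnegative, and vanishes only if B does
    ([mxtrace_sqr_ge0], [mxtrace_sqr_eq0]), that is if d_r G = 2 k G; then G / h^2
    is constant along the radial line ([no_defect_conformal]).

    Integrating the formula over [r, s] x N and letting r and s tend to the ends of
    the interval, one finds that Mb - Ma is the integral of the Ricci term plus a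
    limit of nonnegative numbers ([mass_le]). Fubini is applied to the Ricci term,
    which is integrable on the product; the defect is integrated along each radial
    line by the fundamental theorem of calculus ([defect_ftc]).

    If Mb = Ma, the defect has integral zero over each strip, hence vanishes along
    almost every radial line ([mass_eq_defect]). Nonempty open sets have positive
    Riemannian measure ([riemannian_measure_gt0]) and G is continuous on N, so
    G / h^2 is independent of r at every point ([dense_conformal]). Conversely, the
    radial mass of h^2 Gt is identically zero ([conformal_mass]). If moreover G is
    asymptotic to h^2 Gh, then Gt - Gh has a norm which does not depend on r and is
    arbitrarily small, so it is zero ([asymptotic_same]).

    Compactness of N enters through the finiteness of its measure
    ([riemannian_measure_fin]) and the boundedness of the radial mass on each
    slice. *)

(** * Positive definite matrices *)

Section PositiveDefinite.
Variable R : rcfType.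

(** Symmetry is a separate hypothesis of the lemmas below, as it is in the
    definition of a Riemannian metric. *)
Definition posdef n (A : 'M[R]_n) :=
  forall v : 'rV_n, v != 0 -> 0 < (v *m A *m v^T) ord0 ord0.

(** Cholesky: after splitting off the first diagonal entry a, the Schur complement
    B - a^-1 u^T u is again positive definite, because its value at v is the value
    of the whole form at the vector (- a^-1 v u^T, v). *)
Lemma posdef_factor n (A : 'M[R]_n) : A^T = A -> posdef A ->
  exists2 L : 'M[R]_n, L \in unitmx & A = L *m L^T.
Proof.
elim: n A => [|n IHn] A symA posA.
  by exists 1%:M; [exact: unitmx1 | apply/matrixP => -[? ?]].
suff factor_block (M : 'M[R]_(1 + n)) : M^T = M -> posdef M ->
    exists2 L : 'M[R]_(1 + n), L \in unitmx & M = L *m L^T by exact: factor_block.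
move: M => {A symA posA} A symA posA.
pose a := ulsubmx A ord0 ord0; pose u := ursubmx A; pose B := drsubmx A.
have dlE : dlsubmx A = u^T by rewrite /u trmx_ursub symA.
have BT : B^T = B by rewrite /B trmx_drsub symA.
have AE : A = block_mx a%:M u u^T B.
  by rewrite -dlE /a -mx11_scalar submxK.
have a0 : 0 < a.
  have := posA (row_mx (1%:M : 'M[R]_1) 0).
  rewrite AE tr_row_mx mul_row_block mul_row_col !(mul1mx, mul0mx, mulmx0, addr0).
  rewrite trmx1 trmx0 mulmx1 mulmx0 addr0 mxE eqxx; apply.
  apply/eqP => /matrixP/(_ ord0 (lshift n ord0)).
  by rewrite row_mxEl !mxE eqxx => /eqP; rewrite oner_eq0.
pose C := B - a^-1 *: (u^T *m u).
have CT : C^T = C.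
  by rewrite /C linearB linearZ /= trmx_mul trmxK BT.
have posC : posdef C.
  move=> v v0; have := posA (row_mx (- a^-1 *: (v *m u^T)) v).
  have vu : u *m v^T = (v *m u^T)^T by rewrite trmx_mul trmxK.
  set c := v *m u^T in vu *.
  rewrite AE tr_row_mx mul_row_block mul_row_col -/c mul_mx_scalar scalerA.
  rewrite mulrN divff ?gt_eqF// scaleN1r addNr mul0mx add0r.
  rewrite mulmxDl -scalemxAl mulmxBr mulmxBl -scalemxAr -!scalemxAl !mulmxA.
  rewrite -/c !scaleNr [_ + v *m B *m _]addrC; apply.
  apply/negP => /eqP/matrixP H; case/negP: v0; apply/eqP/matrixP => i j.
  by have := H i (rshift 1 j); rewrite row_mxEr !mxE.
have [K uK CE] := IHn C CT posC.
pose s := Num.sqrt a.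
have ss : s * s = a by rewrite -expr2 sqr_sqrtr// ltW.
have s0 : s != 0 by rewrite gt_eqF// sqrtr_gt0.
exists (block_mx s%:M 0 (s^-1 *: u^T) K).
  rewrite unitmxE det_lblock det_scalar expr1 unitrM unitfE s0 /=.
  by rewrite -unitmxE.
rewrite tr_block_mx mulmx_block AE trmx0 tr_scalar_mx linearZ /= trmxK.
rewrite !(mul0mx, mulmx0, addr0) -scalar_mxM ss mul_scalar_mx mul_mx_scalar.
rewrite !scalerA divff// !scale1r -scalemxAl -scalemxAr scalerA -CE /C.
by rewrite -invfM ss addrC subrK.
Qed.

Lemma posdef_unitmx n (A : 'M[R]_n) : A^T = A -> posdef A -> A \in unitmx.
Proof.
by move=> symA /(posdef_factor symA)[L uL ->]; rewrite unitmx_mul unitmx_tr uL.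
Qed.

Lemma posdef_det_gt0 n (A : 'M[R]_n) : A^T = A -> posdef A -> 0 < \det A.
Proof.
move=> symA /(posdef_factor symA)[L uL ->]; rewrite det_mulmx det_tr -expr2.
by rewrite lt_neqAle sqr_ge0 andbT eq_sym sqrf_eq0 -unitfE -unitmxE.
Qed.

Lemma mxtrace_mulmxtr n (A : 'M[R]_n) :
  \tr (A *m A^T) = \sum_i \sum_j A i j ^+ 2.
Proof.
rewrite /mxtrace; apply: eq_bigr => i _; rewrite mxE.
by apply: eq_bigr => j _; rewrite mxE -expr2.
Qed.

(** If A = L L^T, then A^-1 B is conjugate to the symmetric matrix
    L^-1 B L^-T, and the trace of the square of a symmetric matrix is the sum of
    the squares of its entries. *)
Lemma mxtrace_sqr_conj n (L B : 'M[R]_n) : L \in unitmx -> B^T = B ->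
  \tr (invmx (L *m L^T) *m B *m (invmx (L *m L^T) *m B)) =
  \tr ((invmx L *m B *m (invmx L)^T) *m (invmx L *m B *m (invmx L)^T)^T).
Proof.
move=> uL BT; have uLT : L^T \in unitmx by rewrite unitmx_tr.
have -> : invmx (L *m L^T) = (invmx L)^T *m invmx L.
  have uLL : L *m L^T \in unitmx by rewrite unitmx_mul uL.
  rewrite -[LHS]mulmx1 -[RHS](mulKmx uLL); congr (_ *m _).
  by rewrite -!mulmxA (mulmxA L^T) -trmx_mul mulVmx// trmx1 mul1mx mulmxV.
rewrite !trmx_mul trmxK BT -!mulmxA mxtrace_mulC !mulmxA.
by rewrite -!mulmxA.
Qed.

Lemma mxtrace_sqr_ge0 n (A B : 'M[R]_n) : A^T = A -> posdef A -> B^T = B ->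
  0 <= \tr (invmx A *m B *m (invmx A *m B)).
Proof.
move=> symA /(posdef_factor symA)[L uL ->] BT.
rewrite mxtrace_sqr_conj// mxtrace_mulmxtr.
by apply: sumr_ge0 => i _; apply: sumr_ge0 => j _; exact: sqr_ge0.
Qed.

Lemma mxtrace_sqr_eq0 n (A B : 'M[R]_n) : A^T = A -> posdef A -> B^T = B ->
  \tr (invmx A *m B *m (invmx A *m B)) = 0 -> B = 0.
Proof.
move=> symA /(posdef_factor symA)[L uL ->] BT.
rewrite mxtrace_sqr_conj// mxtrace_mulmxtr => /eqP.
rewrite psumr_eq0 => [/allP H|i _]; last by apply: sumr_ge0 => j _; exact: sqr_ge0.
have C0 : invmx L *m B *m (invmx L)^T = 0.
  apply/matrixP => i j; rewrite [RHS]mxE.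
  have /= := H i (mem_index_enum _).
  rewrite psumr_eq0 => [/allP/(_ j (mem_index_enum _))|k _]; last exact: sqr_ge0.
  by rewrite sqrf_eq0 => /eqP.
have uLT : (invmx L)^T \in unitmx by rewrite unitmx_tr unitmx_inv.
by rewrite -[B](mulKVmx uL) -[invmx L *m B](mulmxK uLT) C0 mul0mx mulmx0.
Qed.

End PositiveDefinite.

(** * Algebras of functions: continuous and C^1 functions *)

Section FunctionAlgebra.
Context {T : Type} {R : realType}.

(** A common interface for continuity and continuous differentiability on an open
    set D: regularity of the entries of a matrix passes to its determinant and to
    its inverse for the same reason in both cases. The last axiom makes P a
    property of the restriction to D, which the inverse needs because [invmx] is
    given by the adjugate only where the matrix is invertible. *)
Record function_algebra (D : set T) (P : (T -> R) -> Prop) : Prop := {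
  fa_cst : forall k, P (fun=> k);
  fa_add : forall f g, P f -> P g -> P (fun x => f x + g x);
  fa_mul : forall f g, P f -> P g -> P (fun x => f x * g x);
  fa_inv : forall f, (forall x, D x -> f x != 0) -> P f -> P (fun x => (f x)^-1);
  fa_ext : forall f g, (forall x, D x -> f x = g x) -> P f -> P g }.

Variables (D : set T) (P : (T -> R) -> Prop).
Hypothesis PA : function_algebra D P.

Lemma fa_sum (I : Type) (r : seq I) (Q : pred I) (f : I -> T -> R) :
  (forall i, P (f i)) -> P (fun x => \sum_(i <- r | Q i) f i x).
Proof.
move=> Pf; elim: r => [|i r IHr].
  by apply: (fa_ext PA _ (fa_cst PA 0)) => x _; rewrite big_nil.
case Qi : (Q i); last by apply: (fa_ext PA _ IHr) => x _; rewrite big_cons Qi.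
by apply: (fa_ext PA _ (fa_add PA (Pf i) IHr)) => x _; rewrite big_cons Qi.
Qed.

Lemma fa_prod (I : Type) (r : seq I) (Q : pred I) (f : I -> T -> R) :
  (forall i, P (f i)) -> P (fun x => \prod_(i <- r | Q i) f i x).
Proof.
move=> Pf; elim: r => [|i r IHr].
  by apply: (fa_ext PA _ (fa_cst PA 1)) => x _; rewrite big_nil.
case Qi : (Q i); last by apply: (fa_ext PA _ IHr) => x _; rewrite big_cons Qi.
by apply: (fa_ext PA _ (fa_mul PA (Pf i) IHr)) => x _; rewrite big_cons Qi.
Qed.

Lemma fa_det n (A : T -> 'M[R]_n) :
  (forall i j, P (fun x => A x i j)) -> P (fun x => \det (A x)).
Proof.
move=> PAij.
apply: (fa_sum _ _ (f := fun (s : {perm 'I_n}) x => (-1) ^+ s * \prod_i A x i (s i))).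
move=> s; apply: (fa_mul PA (fa_cst PA _)).
by apply: (fa_prod _ _ (f := fun i x => A x i (s i))) => i; exact: PAij.
Qed.

Lemma fa_mulmx m n p (A : T -> 'M[R]_(m, n)) (B : T -> 'M[R]_(n, p)) :
  (forall i j, P (fun x => A x i j)) -> (forall i j, P (fun x => B x i j)) ->
  forall i j, P (fun x => (A x *m B x) i j).
Proof.
move=> PA1 PB i j.
apply: (@fa_ext _ _ PA (fun x => \sum_k A x i k * B x k j)) => [x _|].
  by rewrite mxE.
apply: (fa_sum _ _ (f := fun k x => A x i k * B x k j)) => k.
exact: (fa_mul PA).
Qed.

Lemma fa_invmx n (A : T -> 'M[R]_n) : (forall x, D x -> A x \in unitmx) ->
  (forall i j, P (fun x => A x i j)) ->
  forall i j, P (fun x => invmx (A x) i j).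
Proof.
move=> uA PAij i j.
apply: (@fa_ext _ _ PA (fun x => (\det (A x))^-1 * cofactor (A x) j i)).
  by move=> x /uA uAx; rewrite /invmx uAx !mxE.
apply: (fa_mul PA).
  by apply: (fa_inv PA); [move=> x /uA; rewrite unitmxE unitfE | exact: fa_det].
apply: (fa_mul PA (fa_cst PA _)); apply: fa_det => k l.
by apply: (fa_ext PA _ (PAij (lift j k) (lift i l))) => x _; rewrite !mxE.
Qed.

End FunctionAlgebra.

Section ContinuousFunctions.
Context {R : realType}.

Definition continuous_on {T : topologicalType} (D : set T) (f : T -> R) :=
  forall x, D x -> {for x, continuous f}.

Lemma near_continuous {T U : topologicalType} (f g : T -> U) (x : T) :
  (\near x, f x = g x) -> {for x, continuous f} -> {for x, continuous g}.
Proof.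
move=> fg cf; rewrite /prop_for /continuous_at -(nbhs_singleton fg).
exact: cvg_trans (near_eq_cvg fg) cf.
Qed.

Lemma continuous_on_algebra {T : topologicalType} (D : set T) : open D ->
  function_algebra D (@continuous_on T D).
Proof.
move=> oD; split.
- by move=> k x _; exact: cvg_cst.
- by move=> f g cf cg x Dx; apply: cvgD; [exact: cf | exact: cg].
- by move=> f g cf cg x Dx; apply: cvgM; [exact: cf | exact: cg].
- by move=> f f0 cf x Dx; apply: cvgV; [exact: f0 | exact: cf].
- move=> f g fg cf x Dx; apply: near_continuous (cf x Dx).
  by apply: filterS (open_nbhs_nbhs (conj oD Dx)) => y; exact: fg.
Qed.

Definition C1_on (D : set R) (f : R -> R) :=
  forall t, D t -> derivable f t 1 /\ {for t, continuous (derive1 f)}.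

Lemma near_derive1 (f g : R -> R) (t : R) :
  (\near t, f t = g t) -> (derive1 f t) = (derive1 g t).
Proof. by move=> fg; rewrite !derive1E; exact: near_eq_derive. Qed.

Lemma C1_on_ext (D : set R) (f g : R -> R) : open D ->
  (forall t, D t -> f t = g t) -> C1_on D f -> C1_on D g.
Proof.
move=> oD fg cf t Dt; have nD x : D x -> \near x, f x = g x.
  by move=> Dx; apply: filterS (open_nbhs_nbhs (conj oD Dx)) => y; exact: fg.
split; first exact: near_eq_derivable (nD t Dt) (cf t Dt).1.
apply: near_continuous (cf t Dt).2.
by apply: filterS (open_nbhs_nbhs (conj oD Dt)) => y /nD; exact: near_derive1.
Qed.

Lemma C1_onP (D : set R) (f df : R -> R) : open D ->
  (forall t, D t -> is_derive t 1 f (df t)) -> continuous_on D df ->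
  C1_on D f.
Proof.
move=> oD fdf cdf t Dt; have := fdf t Dt => ?; split; first exact: ex_derive.
apply: near_continuous (cdf t Dt).
apply: filterS (open_nbhs_nbhs (conj oD Dt)) => s /fdf ?.
by rewrite derive1E derive_val.
Qed.

Lemma C1_on_derive (D : set R) (f : R -> R) t : C1_on D f -> D t ->
  is_derive t 1 f ((derive1 f t)).
Proof. by move=> cf /cf[df _]; rewrite derive1E; exact/derivableP. Qed.

Lemma C1_on_continuous (D : set R) (f : R -> R) : C1_on D f -> continuous_on D f.
Proof.
by move=> cf t /cf[+ _] => /derivable1_diffP/differentiable_continuous.
Qed.

(** The axioms are checked by exhibiting the derivative given by the usual rules
    and observing that it is continuous. *)
Lemma C1_on_algebra (D : set R) : open D -> function_algebra D (C1_on D).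
Proof.
move=> oD; have cA := continuous_on_algebra oD; split.
- move=> k; apply: (@C1_onP _ _ (fun=> 0)) => // t _.
  exact: cvg_cst.
- move=> f g cf cg; apply: (@C1_onP _ _ (fun t => (derive1 f t) + (derive1 g t))) => //.
    by move=> t Dt; apply: is_deriveD; [exact: C1_on_derive cf Dt | exact: C1_on_derive cg Dt].
  by apply: (fa_add cA) => t; [case/cf | case/cg].
- move=> f g cf cg.
  apply: (@C1_onP _ _ (fun t => f t * (derive1 g t) + g t * (derive1 f t))) => //.
    move=> t Dt; apply: is_deriveM; [exact: C1_on_derive cf Dt|].
    exact: C1_on_derive cg Dt.
  apply: (fa_add cA); apply: (fa_mul cA); try exact: C1_on_continuous.
    by move=> t /cg[].
  by move=> t /cf[].
- move=> f f0 cf.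
  apply: (@C1_onP _ _ (fun t => - ((f t * f t)^-1 * (derive1 f t)))) => //.
    move=> t Dt; have := f0 t Dt => ft0.
    apply: DeriveDef; first by apply: derivableV => //; exact: (cf t Dt).1.
    rewrite deriveV//; last exact: (cf t Dt).1.
    by rewrite -derive1E expr2 scaleNr.
  have cf1 := C1_on_continuous cf.
  apply: (fa_ext cA (f := fun t => (-1) * ((f t * f t)^-1 * (derive1 f t)))).
    by move=> t _; rewrite mulN1r.
  apply: (fa_mul cA (fa_cst cA _)); apply: (fa_mul cA); last by move=> t /cf[].
  apply: (fa_inv cA); last exact: (fa_mul cA).
  by move=> t /f0 ft0; rewrite mulf_neq0.
- by move=> f g; exact: C1_on_ext.
Qed.

Lemma continuous_mx {T : topologicalType} m n (f : T -> 'M[R]_(m, n)) (x : T) :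
  (forall i j, {for x, continuous (fun y => f y i j)}) -> {for x, continuous f}.
Proof.
move=> cf A [P Px PA]; apply: filterS => [y|]; first exact: PA.
by apply: filter_forall => i; apply: filter_forall => j; exact: cf.
Qed.

End ContinuousFunctions.

(** * Smooth functions on a product chart *)

Section RadialCurves.
Context {R : realType}.

Definition oitv (a b : \bar R) : set R := [set r : R | (a < r%:E < b)%E].

Lemma open_oitv (a b : \bar R) : open (oitv a b).
Proof.
have -> : oitv a b = [set r | (a < r%:E)%E] `&` [set r | (r%:E < b)%E].
  by apply/seteqP; split=> r /andP.
by apply: openI; [exact: open_ereal_gt | exact: open_ereal_lt].
Qed.

Lemma near_oitv (a b : \bar R) (r : R) : oitv a b r -> \forall s \near r, oitv a b s.
Proof. by move=> Ir; apply: open_nbhs_nbhs; split=> //; exact: open_oitv. Qed.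

(** The point of coordinates (r, x) of the chart of (a, b) x N. *)
Definition radial_pt {d} (r : R) (x : 'rV[R]_d) : 'rV[R]_(1 + d) :=
  row_mx (r%:M : 'rV[R]_1) x.

Lemma radial_ptE0 d r (x : 'rV[R]_d) : radial_pt r x ord0 (@radial d) = r.
Proof. by rewrite /radial_pt /radial row_mxEl mxE eqxx. Qed.

Lemma rsubmx_radial_pt d r (x : 'rV[R]_d) : rsubmx (radial_pt r x) = x.
Proof. exact: row_mxKr. Qed.

Lemma radial_ptK d (z : 'rV[R]_(1 + d)) :
  radial_pt (z ord0 (@radial d)) (rsubmx z) = z.
Proof.
rewrite -[RHS]hsubmxK; congr row_mx; rewrite [lsubmx z]mx11_scalar.
by rewrite mxE.
Qed.

Lemma radial_ptD d (r t : R) (x : 'rV[R]_d) :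
  radial_pt r x + t *: basis_vec (@radial d) = radial_pt (r + t) x.
Proof.
apply/rowP => j; rewrite !mxE; case: splitP => k /= jk.
  rewrite !mxE [k]ord1 eqxx !mulr1n.
  suff -> : (j == @radial d) by rewrite mulr1.
  by apply/eqP/val_inj; rewrite /= jk [k]ord1.
suff -> : (j == @radial d) = false by rewrite mulr0 addr0.
by apply/eqP => /(congr1 val); rewrite /= jk.
Qed.

Lemma radial_pt_shift d (r t : R) (x : 'rV[R]_d) u :
  radial_pt r x + t *: basis_vec (rshift 1 u) = radial_pt r (x + t *: basis_vec u).
Proof.
apply/rowP => j; rewrite !mxE; case: splitP => k /= jk.
  suff -> : (j == rshift 1 u) = false by rewrite mulr0 addr0.
  by apply/eqP => /(congr1 val); rewrite /= jk [k]ord1.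
rewrite !mxE; congr (_ + t * _%:R).
by rewrite -!val_eqE /= jk eqn_add2l.
Qed.

Lemma continuous_radial_pt {T : topologicalType} d (f : T -> R)
    (g : T -> 'rV[R]_d) p :
  {for p, continuous f} -> {for p, continuous g} ->
  {for p, continuous (fun q => radial_pt (f q) (g q))}.
Proof.
move=> cf cg; apply: continuous_mx => i j; rewrite /radial_pt.
have [k ->|k ->] := split_ordP j.
  rewrite (_ : (fun y => _) = f); first exact: cf.
  by apply/funext => y; rewrite row_mxEl mxE [k]ord1 [i]ord1.
rewrite (_ : (fun y => _) = (fun M : 'rV[R]_d => M i k) \o g).
  by apply: continuous_comp => //; exact: matrix_normedtype.coord_continuous.
by apply/funext => y /=; rewrite row_mxEr.
Qed.

(** The directional derivative of F along the first basis vector and the derivative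
    of F along a radial line are limits of the same difference quotient. *)
Lemma derivable_radial d (F : 'rV[R]_(1 + d) -> R) r (x : 'rV[R]_d) :
  derivable F (radial_pt r x) (basis_vec (@radial d)) ->
  is_derive r 1 (fun t => F (radial_pt t x))
    ('D_(basis_vec (@radial d)) F (radial_pt r x)).
Proof.
have E : (fun h : R => h^-1 *: (((fun t => F (radial_pt t x)) \o shift r) (h *: 1)
            - F (radial_pt r x))) =
    (fun h => h^-1 *: ((F \o shift (radial_pt r x)) (h *: basis_vec (@radial d))
            - F (radial_pt r x))).
  apply/funext => h /=; congr (_ *: (F _ - _)).
  by rewrite [RHS]addrC radial_ptD [h *: _]mulr1 addrC.
move=> dF; apply: DeriveDef; last by rewrite /derive E.
by move: dF; rewrite /derivable -E.
Qed.

End RadialCurves.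

Section ProductChart.
Context {R : realType} {d : nat} {N : ptopologicalType}.
Variable S : smooth_structure R d N.
Variables a b : \bar R.
Implicit Types (c : chart S) (p q : N) (r s t : R).

Let I := oitv a b.

Lemma prod_image_pt c r p : I r -> dom c p ->
  prod_image a b c (radial_pt r (coord c p)).
Proof.
move=> Ir cp; split; first by rewrite radial_ptE0.
by rewrite rsubmx_radial_pt; exists p.
Qed.

Lemma prod_imageP c z : prod_image a b c z ->
  exists r p, [/\ I r, dom c p & z = radial_pt r (coord c p)].
Proof.
move=> [Iz [p cp pz]]; exists (z ord0 (@radial d)), p; split=> //.
by rewrite pz radial_ptK.
Qed.

(** Near a point of the product, f extends to an open set; the k-th term of the
    family F is the k-th radial derivative of that extension. *)
Lemma smooth_radial_extension c (f : 'rV[R]_(1 + d) -> R) r p :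
  smooth_on (prod_image a b c) f -> I r -> dom c p ->
  exists V : set 'rV[R]_(1 + d), exists F : nat -> 'rV[R]_(1 + d) -> R,
  [/\ open V, V (radial_pt r (coord c p)),
      forall k z, V z -> {for z, continuous (F k)},
      forall k s (x : 'rV[R]_d), V (radial_pt s x) ->
        is_derive s 1 (fun t => F k (radial_pt t x)) (F k.+1 (radial_pt s x))
    & forall z, prod_image a b c z -> V z -> F 0%N z = f z].
Proof.
move=> sf Ir cp; have [V [F [oV Vz CF Ff]]] := sf _ (prod_image_pt Ir cp).
pose e := basis_vec (R := R) (@radial d).
have CD k : forall j, Ck_on j V (iter k (fun G z => 'D_e G z) F).
  elim: k => [|k IHk] j; first exact: CF.
  by have [_ /(_ (@radial d))[]] := IHk j.+1.
exists V, (fun k => iter k (fun G z => 'D_e G z) F); split=> //.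
  by move=> k z Vz'; have [+ _] := CD k 0%N; apply.
move=> k s x Vsx; apply: derivable_radial.
by have [_ /(_ (@radial d))[+ _]] := CD k 1%N; apply.
Qed.

Lemma near_dom_pt (V : set 'rV[R]_(1 + d)) c r p : open V -> dom c p ->
  V (radial_pt r (coord c p)) ->
  \forall q \near p, dom c q /\ V (radial_pt r (coord c q)).
Proof.
move=> oV cp Vz; have ? := open_nbhs_nbhs (conj (dom_open c) cp).
near=> q; split; first by near: q.
near: q; have : {for p, continuous (fun q => radial_pt r (coord c q))}.
  by apply: continuous_radial_pt; [exact: cvg_cst | exact: coord_continuous].
by apply; apply: open_nbhs_nbhs; split.
Unshelve. all: by end_near. Qed.

Lemma near_oitv_pt (V : set 'rV[R]_(1 + d)) c r p : open V -> I r ->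
  V (radial_pt r (coord c p)) ->
  \forall s \near r, I s /\ V (radial_pt s (coord c p)).
Proof.
move=> oV Ir Vz; have ? := near_oitv Ir.
near=> s; split; first by near: s.
near: s; have : {for r, continuous (fun s : R => radial_pt s (coord c p))}.
  by apply: continuous_radial_pt; [exact: cvg_id | exact: cvg_cst].
by apply; apply: open_nbhs_nbhs; split.
Unshelve. all: by end_near. Qed.

Section Smooth.
Variables (c : chart S) (f : 'rV[R]_(1 + d) -> R).
Hypothesis sf : smooth_on (prod_image a b c) f.

Let g p t := f (radial_pt t (coord c p)).

(** The radial lines stay in the product chart also at boundary points of N, so the
    radial derivatives of f itself exist and agree with those of the extension. *)
Lemma smooth_radial_local r p : I r -> dom c p ->
  exists V : set 'rV[R]_(1 + d), exists F : nat -> 'rV[R]_(1 + d) -> R,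
  [/\ open V, V (radial_pt r (coord c p)),
      forall k z, V z -> {for z, continuous (F k)},
      (forall s q, I s -> dom c q -> V (radial_pt s (coord c q)) ->
        g q s = F 0%N (radial_pt s (coord c q))) &
      (forall k s q, I s -> dom c q -> V (radial_pt s (coord c q)) ->
        is_derive s 1 (derive1n k (g q)) (F k.+1 (radial_pt s (coord c q))))].
Proof.
move=> Ir cp; have [V [F [oV Vz cF dF Ff]]] := smooth_radial_extension sf Ir cp.
have gE s q : I s -> dom c q -> V (radial_pt s (coord c q)) ->
    g q s = F 0%N (radial_pt s (coord c q)).
  by move=> Is cq Vs; rewrite Ff//; exact: prod_image_pt.
exists V, F; split=> // k.
have ext h (e : N -> R -> R) : (forall s q, I s -> dom c q ->
      V (radial_pt s (coord c q)) -> e q s = F h (radial_pt s (coord c q))) ->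
    forall s q, I s -> dom c q -> V (radial_pt s (coord c q)) ->
    is_derive s 1 (e q) (F h.+1 (radial_pt s (coord c q))).
  move=> eE s q Is cq Vs; have := dF h _ _ Vs.
  apply: near_eq_is_derive.
  apply: filterS (near_oitv_pt oV Is Vs) => t [It Vt].
  by rewrite eE.
apply: (ext k); elim: k => [|k IHk]; first exact: gE.
move=> s q Is cq Vs /=; have := ext k _ IHk s q Is cq Vs => ?.
by rewrite derive1E derive_val.
Qed.

Lemma smooth_radial_C1 k p : dom c p -> C1_on I (derive1n k (g p)).
Proof.
move=> cp r Ir; have [V [F [oV Vz cF _ dg]]] := smooth_radial_local Ir cp.
split; first by have := dg k r p Ir cp Vz => ?; exact: ex_derive.
have : {for r, continuous (fun s => F k.+1 (radial_pt s (coord c p)))}.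
  apply: (@continuous_comp _ _ _ (fun s => radial_pt s (coord c p))).
    by apply: continuous_radial_pt; [exact: cvg_id | exact: cvg_cst].
  exact: cF.
apply: near_continuous; apply: filterS (near_oitv_pt oV Ir Vz) => s [Is Vs].
by have := dg k s p Is cp Vs => ?; rewrite derive1E derive_val.
Qed.

Lemma smooth_radial_continuous k r : I r ->
  continuous_on (dom c) (fun p => derive1n k (g p) r).
Proof.
move=> Ir p cp; have [V [F [oV Vz cF gE dg]]] := smooth_radial_local Ir cp.
have : {for p, continuous (fun q => F k (radial_pt r (coord c q)))}.
  apply: (@continuous_comp _ _ _ (fun q => radial_pt r (coord c q))).
    by apply: continuous_radial_pt; [exact: cvg_cst | exact: coord_continuous].
  exact: cF.
apply: near_continuous; apply: filterS (near_dom_pt oV cp Vz) => q [cq Vq].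
case: k => [|k] /=; first by rewrite gE.
by have := dg k r q Ir cq Vq => ?; rewrite derive1E derive_val.
Qed.

End Smooth.
End ProductChart.

(** * Approaching the ends of the interval *)

Section IntervalEnds.
Context {R : realType}.
Implicit Types (a b : \bar R) (r t : R).

Lemma oitv_ex a b : (a < b)%E -> exists c, oitv a b c.
Proof.
case: a b => [a||] [b||] // ab.
- by exists ((a + b) / 2); rewrite /oitv /= !lte_fin midf_lt // midf_lt.
- by exists (a + 1); rewrite /oitv /= ltry lte_fin ltrDl ltr01.
- by exists (b - 1); rewrite /oitv /= ltNyr lte_fin ltrBlDr ltrDl ltr01.
- by exists 0; rewrite /oitv /= ltNyr ltry.
Qed.

Lemma cvg_nbhs_in a b (r0 : \bar R) (u : nat -> R) : (forall n, oitv a b (u n)) ->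
  (u n)%:E @[n --> \oo] --> r0 -> u n @[n --> \oo] --> nbhs_in a b r0.
Proof.
move=> Iu ur0 A r0A; have [n0 _ nA] := ur0 _ r0A.
by exists n0 => // n /nA; apply; exact: Iu.
Qed.

(** Limits at the ends will be used along sequences, since dominated convergence is
    a statement about sequences. *)
Lemma cvg_left_end a b : (a < b)%E ->
  exists2 u : nat -> R, (forall n, oitv a b (u n)) & (u n)%:E @[n --> \oo] --> a.
Proof.
move=> ab; have [c /andP[ac cb]] := oitv_ex ab.
case: a ac {ab} => [a||] //; last move=> _.
  rewrite lte_fin => ac; have ca0 : 0 < c - a by rewrite subr_gt0.
  exists (fun n => a + (c - a) * harmonic n) => [n|].
    rewrite /oitv /= lte_fin ltrDl mulr_gt0 ?invr_gt0 ?ltr0n//=.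
    apply: le_lt_trans cb; rewrite lee_fin -lerBrDl ger_pMr//.
    by rewrite invf_le1 ?ltr0n// ler1n.
  apply: cvg_EFin; first by near=> n.
  have : a + (c - a) * harmonic n @[n --> \oo] --> a + (c - a) * 0.
    apply: cvgD; first exact: cvg_cst.
    by apply: cvgM; [exact: cvg_cst | exact: cvg_harmonic].
  by rewrite mulr0 addr0.
exists (fun n => c - n%:R) => [n|].
  by rewrite /oitv /= ltNyr (le_lt_trans _ cb)// lee_fin lerBlDr lerDl ler0n.
move=> A [M [_ MA]]; have [n0 _ nM] := nbhs_infty_gtr (c - M).
exists n0 => // n /nM /= cMn.
by apply: MA; rewrite lte_fin ltrBlDr addrC -ltrBlDr.
Unshelve. all: by end_near. Qed.

Lemma cvg_right_end a b : (a < b)%E ->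
  exists2 u : nat -> R, (forall n, oitv a b (u n)) & (u n)%:E @[n --> \oo] --> b.
Proof.
rewrite -lteN2 => /cvg_left_end[u Iu ub]; exists (fun n => - u n) => [n|].
  have := Iu n; rewrite /oitv /= => /andP[bu ua].
  by rewrite EFinN lteNr ua lteNl bu.
have nub := cvgeN ub; rewrite oppeK in nub.
by move=> A /nub.
Qed.

Lemma nbhs_in_ex a b (r0 : \bar R) A : (a < b)%E -> (a <= r0 <= b)%E ->
  nbhs_in a b r0 A -> exists2 r, oitv a b r & A r.
Proof.
move=> ab /andP[ar0 r0b] r0A.
have seq_ex u : (forall n, oitv a b (u n)) -> (u n)%:E @[n --> \oo] --> r0 ->
    exists2 r, oitv a b r & A r.
  move=> Iu ur0; have [n _ nA] := cvg_nbhs_in Iu ur0 r0A.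
  by exists (u n) => //; exact: nA n (leqnn n).
move: ar0; rewrite le_eqVlt => /predU1P[ar0|ar0].
  by have [u Iu ua] := cvg_left_end ab; apply: seq_ex Iu _; rewrite -ar0.
move: r0b; rewrite le_eqVlt => /predU1P[r0b|r0b].
  by have [u Iu ua] := cvg_right_end ab; apply: seq_ex Iu _; rewrite r0b.
case: r0 ar0 r0b r0A {seq_ex} => [r||] ar rb rA.
- have Ir : oitv a b r by apply/andP.
  by exists r => //; apply: (nbhs_singleton rA).
- by move: rb; rewrite ltNge leey.
- by move: ar; rewrite ltNge leNye.
Qed.

Lemma nbhs_in_proper a b (r0 : \bar R) : (a < b)%E -> (a <= r0 <= b)%E ->
  ProperFilter (nbhs_in a b r0).
Proof.
move=> ab r0ab; apply: Build_ProperFilter_ex => A /(nbhs_in_ex ab r0ab)[r _ Ar].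
by exists r.
Qed.

Lemma near_nbhs_in a b (r0 : \bar R) (f g : R -> R) (l : R) : (a < b)%E ->
  (forall r, oitv a b r -> f r = g r) ->
  f r @[r --> nbhs_in a b r0] --> l -> g r @[r --> nbhs_in a b r0] --> l.
Proof.
move=> ab fg fl A Al; 
have {fl}flA : nbhs r0 (fun s : \bar R => (a < s < b)%E -> A (f (fine s))) := fl A Al.
suff : nbhs r0 (fun s : \bar R => (a < s < b)%E -> A (g (fine s))) by [].
apply: filterS flA => -[r||] sA Is.
- by rewrite /= -fg//; exact: sA.
- by move: Is => /andP[_]; rewrite ltNge leey.
- by move: Is => /andP[]; rewrite ltNge leNye.
Qed.

End IntervalEnds.

(** * Curvature of dr^2 + G(r) in coordinates *)

Section RelativePartials.
Context {R : realType}.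

Lemma lim_const_near {T : Type} (F : set_system T) (f : T -> R) (k : R) :
  ProperFilter F -> (\near F, f F = k) -> lim (f x @[x --> F]) = k.
Proof.
move=> FF fk; apply/cvg_lim => //.
have kF : cst k x @[x --> F] --> k by exact: cvg_cst.
apply: cvg_trans _ kF; apply: near_eq_cvg.
by apply: filterS fk => x ->.
Qed.

(** A relative partial derivative is a limit along a filter which has to be proper
    for its value to be determined, even when the function is constant. Positive
    increments are the ones that stay in a half-space. *)
Lemma proper_within_dnbhs0 (A : set R) :
  (forall e : R, 0 < e -> exists t, [/\ 0 < t, t < e & A t]) ->
  ProperFilter (within A (0 : R)^').
Proof.
move=> Asmall; apply: Build_ProperFilter_ex => P.
rewrite /within /= => -[e /= e0 eP]; have [t [t0 te At]] := Asmall e e0.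
exists t; apply: eP => //=; last by rewrite gt_eqF.
by rewrite sub0r normrN gtr0_norm.
Qed.

Lemma partial_cst m (A : set 'rV[R]_m) i (f : 'rV[R]_m -> R) (k : R) z :
  ProperFilter (within [set t : R | A (z + t *: basis_vec i)] (0 : R)^') ->
  (forall y, A y -> f y = k) -> A z -> partial A i f z = 0.
Proof.
move=> PF fk Az; apply: lim_const_near.
near=> t; rewrite !fk ?subrr ?mulr0//.
by near: t; apply: withinT.
Unshelve. all: by end_near. Qed.

End RelativePartials.

Section ProductCurvature.
Context {R : realType} {d : nat} {N : ptopologicalType}.
Variable S : smooth_structure R d N.
Variables a b : \bar R.
Implicit Types (c : chart S) (p q : N) (r s t : R).

Let I := oitv a b.

Lemma proper_prod_image c r p (i : 'I_(1 + d)) : I r -> dom c p ->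
  ProperFilter (within [set t : R | prod_image a b c
    (radial_pt r (coord c p) + t *: basis_vec i)] (0 : R)^').
Proof.
move=> Ir cp; apply: proper_within_dnbhs0 => e e0.
have [k ->|u ->] := split_ordP i.
  have -> : lshift d k = @radial d by rewrite /radial [k]ord1.
  have /nbhs_ballP[e' /= e'0 eI] := near_oitv Ir.
  pose t := Num.min e e' / 2.
  have m0 : 0 < Num.min e e' by rewrite lt_min e0.
  have tm : t < Num.min e e' by rewrite /t; lra.
  exists t; split; [by rewrite divr_gt0| |].
    by apply: lt_le_trans tm _; rewrite ge_min lexx.
  rewrite /= radial_ptD; apply: prod_image_pt => //; apply: eI.
  rewrite /ball /= opprD addNKr normrN gtr0_norm ?divr_gt0//.
  by apply: lt_le_trans tm _; rewrite ge_min lexx orbT.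
have [W oW WE] := coord_open (dom_open c) (@subset_refl _ (dom c)).
have [Wx Hx] : (W `&` @half_space R d) (coord c p) by rewrite -WE; exists p.
have ct : {for (0 : R), continuous (fun t : R => coord c p + t *: basis_vec u)}.
  apply: cvgD; first exact: cvg_cst.
  by apply: cvgZr_tmp; exact: cvg_id.
have := ct W; rewrite scale0r addr0 => /(_ (open_nbhs_nbhs (conj oW Wx))).
move=> /nbhs_ballP[e' /= e'0 eW].
pose t := Num.min e e' / 2.
have m0 : 0 < Num.min e e' by rewrite lt_min e0.
have tm : t < Num.min e e' by rewrite /t; lra.
have t0 : 0 < t by rewrite divr_gt0.
exists t; split=> //.
  by apply: lt_le_trans tm _; rewrite ge_min lexx.
have : (W `&` @half_space R d) (coord c p + t *: basis_vec u).
  split.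
    apply: eW; rewrite /ball /= sub0r normrN gtr0_norm//.
    by apply: lt_le_trans tm _; rewrite ge_min lexx orbT.
  move=> j j0; rewrite !mxE addr_ge0 ?Hx// mulr_ge0 ?ler0n//.
  exact: ltW.
rewrite -WE => -[q cq qE]; rewrite /= radial_pt_shift -qE.
exact: prod_image_pt.
Qed.

Lemma partial_prod_cst c i f (k : R) r p :
  (forall y, prod_image a b c y -> f y = k) -> I r -> dom c p ->
  partial (prod_image a b c) i f (radial_pt r (coord c p)) = 0.
Proof.
move=> fk Ir cp; apply: (partial_cst _ fk); last exact: prod_image_pt.
exact: proper_prod_image.
Qed.

Lemma partial_radial c f r p : I r -> dom c p ->
  partial (prod_image a b c) (@radial d) f (radial_pt r (coord c p)) =
  derive1 (fun t => f (radial_pt t (coord c p))) r.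
Proof.
move=> Ir cp; rewrite /partial /derive1.
have -> : within [set t : R | prod_image a b c
    (radial_pt r (coord c p) + t *: basis_vec (@radial d))] (0 : R)^' = (0 : R)^'.
  have nI : \forall t \near (0 : R)^', prod_image a b c
      (radial_pt r (coord c p) + t *: basis_vec (@radial d)).
    have /nbhs_ballP[e /= e0 eI] := near_oitv Ir.
    exists e => //= t /=; rewrite sub0r normrN => te _.
    rewrite radial_ptD; apply: prod_image_pt => //; apply: eI.
    by rewrite /ball /= opprD addNKr normrN.
  apply/seteqP; split=> P; rewrite /within /=.
    by move=> PI; apply: filterS2 nI PI => t It; apply.
  by apply: filterS => t.
set u := (X in lim (fmap X _)); set v := (X in _ = lim (fmap X _)).
suff -> : u = v by [].
by apply/funext => t; rewrite /u /v radial_ptD [r + t]addrC.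
Qed.

Variable G : R -> tensor2 S.

Definition radial_derive c p r : 'M[R]_d :=
  \matrix_(u, v) derive1 (fun t => G t c p u v) r.

(** The Weingarten map of N(r) in the chart c. *)
Definition radial_shape c p r : 'M[R]_d :=
  2^-1 *: (invmx (G r c p) *m (radial_derive c p r)^T).

Let A c := prod_image a b c.
Let g c := prod_metric G c.

Lemma prod_metric_pt c r p : dom c p ->
  prod_metric G c (radial_pt r (coord c p)) = block_mx 1%:M 0 0 (G r c p).
Proof.
by move=> cp; rewrite /prod_metric radial_ptE0 rsubmx_radial_pt coordK.
Qed.

Let g_rad c y l : g c y (@radial d) l = (l == @radial d)%:R.
Proof.
rewrite /g /prod_metric /radial block_mxEh; have [k ->|k ->] := split_ordP l.
  by rewrite row_mxEl col_mxEu mxE [k]ord1 !eqxx.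
rewrite row_mxEr col_mxEu mxE.
by case: eqP => // /(congr1 val).
Qed.

Let g_radT c y l : g c y l (@radial d) = (l == @radial d)%:R.
Proof.
rewrite /g /prod_metric /radial block_mxEv; have [k ->|k ->] := split_ordP l.
  by rewrite col_mxEu row_mxEl mxE [k]ord1 !eqxx.
rewrite col_mxEd row_mxEl mxE.
by case: eqP => // /(congr1 val).
Qed.

Let partial_rad c i l r p : I r -> dom c p ->
  partial (A c) i (fun y => g c y (@radial d) l) (radial_pt r (coord c p)) = 0.
Proof.
move=> Ir cp.
exact: (partial_prod_cst i (fun y _ => g_rad c y l) Ir cp).
Qed.

Let partial_radT c i l r p : I r -> dom c p ->
  partial (A c) i (fun y => g c y l (@radial d)) (radial_pt r (coord c p)) = 0.
Proof.
move=> Ir cp.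
exact: (partial_prod_cst i (fun y _ => g_radT c y l) Ir cp).
Qed.

Let partial_tan c u v r p : I r -> dom c p ->
  partial (A c) (@radial d) (fun y => g c y (rshift 1 u) (rshift 1 v))
    (radial_pt r (coord c p)) = radial_derive c p r u v.
Proof.
move=> Ir cp; rewrite partial_radial// mxE; congr (derive1 _ r).
by apply/funext => t; rewrite /g prod_metric_pt// block_mxEdr.
Qed.

Section At.
Variables (c : chart S) (r : R) (p : N).
Hypotheses (Ir : I r) (cp : dom c p) (uG : G r c p \in unitmx).
Let z := radial_pt r (coord c p).
Let Gamma := christoffel (A c) (g c).

Let inv_g : invmx (g c z) = block_mx 1%:M 0 0 (invmx (G r c p)).
Proof.
rewrite /g prod_metric_pt// invmx_block_diag ?invmx1//.
by rewrite unitmxE det_ublock det1 mul1r -unitmxE.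
Qed.

(** Radial lines are geodesics, because the coefficients g_rr = 1 and g_rv = 0 are
    constant. *)
Lemma christoffel_rad_rad k : Gamma k (@radial d) (@radial d) z = 0.
Proof.
rewrite /Gamma /christoffel big1 ?mulr0// => l _.
by rewrite !partial_rad// addr0 subr0 mulr0.
Qed.

Lemma christoffel_rad_up i : Gamma (@radial d) (@radial d) i z = 0.
Proof.
rewrite /Gamma /christoffel inv_g big_split_ord /= big_ord1.
rewrite [X in _ * (_ + X)]big1 ?addr0; last first.
  by move=> l _; rewrite /radial block_mxEur mxE mul0r.
rewrite -/(@radial d).
by rewrite !partial_radT// ?partial_rad// addr0 subr0 !mulr0.
Qed.

Lemma christoffel_tan u v :
  Gamma (rshift 1 u) (rshift 1 v) (@radial d) z = radial_shape c p r u v.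
Proof.
rewrite /Gamma /christoffel inv_g big_split_ord /= big1 ?add0r; last first.
  by move=> l _; rewrite block_mxEdl mxE mul0r.
rewrite [RHS]mxE; congr (_ * _); rewrite [RHS]mxE; apply: eq_bigr => l _.
rewrite block_mxEdr partial_rad// partial_tan// partial_radT//.
by rewrite add0r subr0 [in RHS]mxE.
Qed.

Lemma christoffel_tanT u v :
  Gamma (rshift 1 u) (@radial d) (rshift 1 v) z = radial_shape c p r u v.
Proof.
rewrite /Gamma /christoffel inv_g big_split_ord /= big1 ?add0r; last first.
  by move=> l _; rewrite block_mxEdl mxE mul0r.
rewrite [RHS]mxE; congr (_ * _); rewrite [RHS]mxE; apply: eq_bigr => l _.
rewrite block_mxEdr !partial_rad// partial_tan//.
by rewrite addr0 subr0 [in RHS]mxE.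
Qed.

End At.

Lemma mean_curvatureE r p : I r -> G r (chart_at S p) p \in unitmx ->
  mean_curvature a b G r p = \tr (radial_shape (chart_at S p) p r).
Proof.
move=> Ir uG; apply: eq_bigr => u _; rewrite mxE.
exact: (christoffel_tan Ir (dom_chart_at S p) uG).
Qed.

(** The trace of the Riccati equation: the symbols with two radial indices, or with
    an upper radial and a lower radial index, vanish, so that only the radial
    derivative of the Weingarten map and its square remain. *)
Lemma ricci_rrE r p : I r ->
  (forall t c q, I t -> dom c q -> G t c q \in unitmx) ->
  ricci_rr a b G r p =
  \sum_u (- derive1 (fun t => radial_shape (chart_at S p) p t u u) r) -
  \tr (radial_shape (chart_at S p) p r *m radial_shape (chart_at S p) p r).
Proof.
move=> Ir uG; have cp := dom_chart_at S p.
rewrite /ricci_rr /ricci; set c := chart_at S p in cp *.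
have Gamma_rr k y : A c y -> christoffel (A c) (g c) k (@radial d) (@radial d) y = 0.
  by move=> /prod_imageP[s [q [Is cq ->]]]; apply: christoffel_rad_rad.
have Gamma_rup i y : A c y -> christoffel (A c) (g c) (@radial d) (@radial d) i y = 0.
  by move=> /prod_imageP[s [q [Is cq ->]]]; apply: christoffel_rad_up => //; exact: uG.
have Az : A c (radial_pt r (coord c p)) by exact: prod_image_pt.
have partial0 i f : (forall y, A c y -> f y = 0) ->
    partial (A c) i f (radial_pt r (coord c p)) = 0 :> R.
  by move=> f0; apply: partial_prod_cst (f0) Ir cp.
rewrite big_split_ord /= big_ord1 -/(@radial d).
rewrite big1 => [|i _]; last by rewrite Gamma_rup// !mul0r subrr.
rewrite !partial0 => [|y Ay]; last exact: Gamma_rr.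
rewrite subrr addr0 add0r /mxtrace -sumrB; apply: eq_bigr => u _.
rewrite partial0 ?sub0r; last by move=> y; exact: Gamma_rr.
rewrite partial_radial//; congr (- _ + _).
  apply: near_derive1; apply: filterS (near_oitv Ir) => t It.
  by apply: christoffel_tanT => //; exact: uG.
rewrite big_split_ord /= big_ord1 -/(@radial d) !Gamma_rr// !mulr0 mul0r subrr add0r.
rewrite [in RHS]mxE -sumrN; apply: eq_bigr => v _.
rewrite Gamma_rr// mulr0 sub0r christoffel_tanT ?christoffel_tan//; exact: uG.
Qed.

End ProductCurvature.

(** * Families of metrics: change of chart and regularity *)

Section DeriveMatrix.
Context {R : realType}.

Lemma is_derive_lincomb n (k : 'I_n -> R) (f : 'I_n -> R -> R) (df : 'I_n -> R) (t : R) :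
  (forall i, is_derive t 1 (f i) (df i)) ->
  is_derive t 1 (fun s => \sum_i k i * f i s) (\sum_i k i * df i).
Proof.
move=> fdf; rewrite (_ : (fun s => _) = \sum_i (fun s => k i * f i s)); last first.
  by apply/funext => s; rewrite fct_sumE.
by apply: is_derive_sum => i; have := fdf i => ?; exact: is_deriveZ.
Qed.

(** The change of chart on N does not depend on r. *)
Lemma derive1_conj n (J : 'M[R]_n) (M M' : R -> 'M[R]_n) (r : R) :
  (\near r, M r = J *m M' r *m J^T) ->
  (forall u v, derivable (fun t => M' t u v) r 1) ->
  (\matrix_(u, v) derive1 (fun t => M t u v) r) =
  J *m (\matrix_(u, v) derive1 (fun t => M' t u v) r) *m J^T.
Proof.
move=> MJ dM'; apply/matrixP => u v; rewrite mxE.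
have E t : (J *m M' t *m J^T) u v =
    \sum_l J v l * \sum_k J u k * M' t k l.
  rewrite mxE; apply: eq_bigr => l _; rewrite !mxE mulrC; congr (_ * _).
rewrite (@near_derive1 _ _ (fun t => \sum_l J v l * \sum_k J u k * M' t k l)).
  have dE : is_derive r 1 (fun t => \sum_l J v l * \sum_k J u k * M' t k l)
      (\sum_l J v l * \sum_k J u k * derive1 (fun t => M' t k l) r).
    apply: is_derive_lincomb => l; apply: is_derive_lincomb => k.
    by rewrite derive1E; exact/derivableP.
  rewrite derive1E derive_val mxE; apply: eq_bigr => l _; rewrite !mxE mulrC.
  by congr (_ * _); apply: eq_bigr => k _; rewrite mxE.
by apply: filterS MJ => t ->; exact: E.
Qed.

End DeriveMatrix.

Section MetricFamily.
Context {R : realType} {d : nat} {N : ptopologicalType}.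
Variable S : smooth_structure R d N.
Variables a b : \bar R.
Implicit Types (c : chart S) (p q : N) (r s t : R).

Let I := oitv a b.

Lemma metric_posdef (g : tensor2 S) c p : is_riemannian_metric g -> dom c p ->
  posdef (g c p).
Proof. by move=> [_ + _ _] cp v v0 => /(_ c p v cp v0). Qed.

Lemma metric_sym (g : tensor2 S) c p : is_riemannian_metric g -> dom c p ->
  (g c p)^T = g c p.
Proof. by move=> [+ _ _ _] cp; apply. Qed.

Lemma metric_unit (g : tensor2 S) c p : is_riemannian_metric g -> dom c p ->
  g c p \in unitmx.
Proof.
by move=> gR cp; apply: posdef_unitmx; [exact: metric_sym|exact: metric_posdef].
Qed.

Lemma metric_det_gt0 (g : tensor2 S) c p : is_riemannian_metric g -> dom c p ->
  0 < \det (g c p).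
Proof.
by move=> gR cp; apply: posdef_det_gt0; [exact: metric_sym|exact: metric_posdef].
Qed.

Lemma metric_chart (g : tensor2 S) c c' p : is_riemannian_metric g ->
  dom c p -> dom c' p ->
  g c p = transition_jacobian c c' p *m g c' p *m (transition_jacobian c c' p)^T.
Proof. by move=> [_ _ + _]; apply. Qed.

(** In g = J g' J^T the left-hand side is invertible, hence so is J. *)
Lemma jacobian_unit (g : tensor2 S) c c' p : is_riemannian_metric g ->
  dom c p -> dom c' p -> transition_jacobian c c' p \in unitmx.
Proof.
move=> gR cp c'p; have := metric_unit gR cp.
by rewrite (metric_chart gR cp c'p) !unitmx_mul => /andP[/andP[]].
Qed.

Variable G : R -> tensor2 S.
Hypothesis hG : is_metric_family a b G.

Let GR r : I r -> is_riemannian_metric (G r).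
Proof. exact: hG.1. Qed.

Let GE c u v t p : dom c p -> G t c p u v =
  prod_metric G c (radial_pt t (coord c p)) (rshift 1 u) (rshift 1 v).
Proof. by move=> cp; rewrite prod_metric_pt// block_mxEdr. Qed.

Lemma metric_C1 k c p u v : dom c p -> C1_on I (derive1n k (fun t => G t c p u v)).
Proof.
move=> cp; have := smooth_radial_C1 (hG.2 c (rshift 1 u) (rshift 1 v)) k cp.
congr (C1_on _ (derive1n _ _)); apply/funext => t; exact/esym/GE.
Qed.

Lemma metric_continuous k c r u v : I r ->
  continuous_on (dom c) (fun p => derive1n k (fun t => G t c p u v) r).
Proof.
move=> Ir.
apply: (fa_ext (continuous_on_algebra (dom_open c)) _
  (smooth_radial_continuous (hG.2 c (rshift 1 u) (rshift 1 v)) (k := k) Ir)).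
move=> p cp; congr (derive1n _ _ _); apply/funext => t; exact/esym/GE.
Qed.

Lemma radial_derive_sym c p r : I r -> dom c p ->
  (radial_derive G c p r)^T = radial_derive G c p r.
Proof.
move=> Ir cp; apply/matrixP => u v; rewrite !mxE; apply: near_derive1.
apply: filterS (near_oitv Ir) => t It.
by rewrite -[in RHS](metric_sym (GR It) cp) mxE.
Qed.

Lemma radial_derive_chart c c' p r : I r -> dom c p -> dom c' p ->
  radial_derive G c p r = transition_jacobian c c' p *m radial_derive G c' p r
                          *m (transition_jacobian c c' p)^T.
Proof.
move=> Ir cp c'p; apply: derive1_conj.
  by apply: filterS (near_oitv Ir) => t It; exact: metric_chart (GR It) cp c'p.
by move=> u v; exact: (metric_C1 0 u v c'p Ir).1.
Qed.

(** The Weingarten maps in two charts are conjugate. This is what makes the mean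
    curvature, evaluated at each point in a chart chosen at that point, a
    continuous function on N. *)
Lemma trace_radial_shape_chart c c' p r : I r -> dom c p -> dom c' p ->
  \tr (radial_shape G c p r) = \tr (radial_shape G c' p r).
Proof.
move=> Ir cp c'p; rewrite /radial_shape !linearZ /=; congr (_ * _).
rewrite !radial_derive_sym// (radial_derive_chart Ir cp c'p).
rewrite (metric_chart (GR Ir) cp c'p).
set J := transition_jacobian c c' p.
have uJ : J \in unitmx by exact: jacobian_unit (GR Ir) cp c'p.
have uG := metric_unit (GR Ir) c'p.
have uJT : J^T \in unitmx by rewrite unitmx_tr.
have -> : invmx (J *m G r c' p *m J^T) = invmx J^T *m invmx (G r c' p) *m invmx J.
  rewrite -[RHS]mulmx1 -(@mulmxV _ _ (J *m G r c' p *m J^T)).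
    rewrite !mulmxA mulmxKV// -(mulmxA (invmx J^T)) mulVmx// mulmx1 mulVmx//.
    by rewrite mul1mx.
  by rewrite !unitmx_mul uJ uG.
by rewrite !mulmxA mulmxKV// mxtrace_mulC !mulmxA mulmxV// mul1mx.
Qed.

Lemma continuous_mean_curvature r : I r -> continuous (mean_curvature a b G r).
Proof.
move=> Ir p; set c := chart_at S p; have cp := dom_chart_at S p.
have cA := continuous_on_algebra (dom_open c) (R := R).
have cH : continuous_on (dom c) (fun q => \tr (radial_shape G c q r)).
  apply: (fa_sum cA) => u.
  apply: (fa_ext cA (f := fun q => 2^-1 *
      (invmx (G r c q) *m (radial_derive G c q r)^T) u u)) => [q cq|].
    by rewrite [RHS]mxE.
  apply: (fa_mul cA (fa_cst cA _)); apply: (fa_mulmx cA) => i j.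
    apply: (fa_invmx cA) => [q cq|k l]; first exact: metric_unit (GR Ir) cq.
    exact: (@metric_continuous 0 c r k l Ir).
  apply: (fa_ext cA _ (@metric_continuous 1 c r j i Ir)) => q cq.
  by rewrite !mxE.
apply: near_continuous (cH p cp).
apply: filterS (open_nbhs_nbhs (conj (dom_open c) cp)) => q cq.
have cqq := dom_chart_at S q.
rewrite (mean_curvatureE Ir (metric_unit (GR Ir) cqq)).
exact: trace_radial_shape_chart Ir cq cqq.
Qed.

Lemma radial_shape_C1 c p u v : dom c p ->
  C1_on I (fun t => radial_shape G c p t u v).
Proof.
move=> cp; have cA := C1_on_algebra (@open_oitv R a b).
apply: (fa_ext cA (f := fun t => 2^-1 *
      (invmx (G t c p) *m (radial_derive G c p t)^T) u v)) => [t It|].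
  by rewrite [RHS]mxE.
apply: (fa_mul cA (fa_cst cA _)); apply: (fa_mulmx cA) => i j.
  apply: (fa_invmx cA) => [t It|k l]; first exact: metric_unit (GR It) cp.
  exact: (@metric_C1 0 c p k l cp).
apply: (fa_ext cA _ (@metric_C1 1 c p j i cp)) => q cq.
by rewrite !mxE.
Qed.

Lemma derive1_trace_shape c p r : I r -> dom c p ->
  is_derive r 1 (fun t => \tr (radial_shape G c p t))
    (\sum_u derive1 (fun t => radial_shape G c p t u u) r).
Proof.
move=> Ir cp.
have := @is_derive_lincomb R d (fun=> 1) (fun u t => radial_shape G c p t u u)
  (fun u => derive1 (fun t => radial_shape G c p t u u) r) r.
under eq_bigr do rewrite mul1r.
under eq_fun do under eq_bigr do rewrite mul1r.
by apply=> u; apply: C1_on_derive (radial_shape_C1 u u cp) Ir.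
Qed.

End MetricFamily.

(** * The pointwise monotonicity formula *)

Section Monotonicity.
Context {R : realType} {d : nat} {N : ptopologicalType}.
Variable S : smooth_structure R d N.
Variables a b : \bar R.
Implicit Types (c : chart S) (p q : N) (r s t : R).

Let I := oitv a b.

Lemma radial_shape_ext (G G' : R -> tensor2 S) c p t : same_family a b G G' ->
  I t -> dom c p -> radial_shape G c p t = radial_shape G' c p t.
Proof.
move=> GG' It cp; rewrite /radial_shape GG'//; congr (_ *: (_ *m _^T)).
apply/matrixP => u v; rewrite !mxE; apply: near_derive1.
by apply: filterS (near_oitv It) => s Is; rewrite GG'.
Qed.

Variable h : R -> R.
Hypotheses (h_smooth : smooth_on_itv a b h) (h_pos : forall r, I r -> 0 < h r).

Definition log_derive t := derive1 h t / h t.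

Let oI : open I. Proof. exact: open_oitv. Qed.
Let C1A := C1_on_algebra oI.
Let h_neq0 t : I t -> h t != 0. Proof. by move=> /h_pos/gt_eqF->. Qed.

Lemma smooth_on_itv_C1 k : C1_on I (derive1n k h).
Proof.
move=> t It; split; first exact: h_smooth.
by have /derivable1_diffP/differentiable_continuous := @h_smooth k.+1 t It.
Qed.

Let h_C1 : C1_on I h. Proof. exact: (smooth_on_itv_C1 0). Qed.

Lemma log_derive_C1 : C1_on I log_derive.
Proof.
apply: (fa_mul C1A (smooth_on_itv_C1 1)).
by apply: (fa_inv C1A) => // t; exact: h_neq0.
Qed.

Lemma warped_unit (Gt : tensor2 S) c p t : is_riemannian_metric Gt -> I t ->
  dom c p -> warped h Gt t c p \in unitmx.
Proof.
move=> gR It cp; rewrite /warped unitmxZ ?(metric_unit gR cp)//.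
by rewrite unitfE sqrf_eq0 h_neq0.
Qed.

(** The slices of a warped product are umbilical. *)
Lemma warped_shape (Gt : tensor2 S) c p t : is_riemannian_metric Gt -> I t ->
  dom c p -> radial_shape (warped h Gt) c p t = (log_derive t)%:M.
Proof.
move=> gR It cp; have uG := metric_unit gR cp.
rewrite /radial_shape /warped invmxZ; last exact: warped_unit.
have -> : (radial_derive (fun r c p => h r ^+ 2 *: Gt c p) c p t)^T =
    (2 * h t * derive1 h t) *: Gt c p.
  apply/matrixP => u v; rewrite !mxE.
  have dh := C1_on_derive h_C1 It.
  rewrite (_ : (fun t => _) = (fun s => (Gt c p v u * h s) * h s)); last first.
    by apply/funext => s; rewrite mxE expr2; ring.
  rewrite -[in RHS](metric_sym gR cp) mxE derive1E.
  have dGh : is_derive t 1 (fun s => Gt c p v u * h s) (Gt c p v u * derive1 h t).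
    exact: is_deriveZ.
  have -> : 'D_1 (fun s => Gt c p v u * h s * h s) t =
     (Gt c p v u * h t) * derive1 h t + h t * (Gt c p v u * derive1 h t).
    by apply: derive_val; exact: is_deriveM.
  by ring.
rewrite -scalemxAl -scalemxAr mulVmx// !scalerA scalemx1; congr (_%:M).
by rewrite /log_derive; field; exact: h_neq0.
Qed.

Lemma warped_mean_curvature (Gt : tensor2 S) t p : is_riemannian_metric Gt ->
  I t -> mean_curvature a b (warped h Gt) t p = log_derive t *+ d.
Proof.
move=> gR It; have cp := dom_chart_at S p.
by rewrite mean_curvatureE ?warped_shape ?mxtrace_scalar//; exact: warped_unit.
Qed.

Lemma warped_ricci_rr (Gt : tensor2 S) t p : is_riemannian_metric Gt -> I t ->
  ricci_rr a b (warped h Gt) t p =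
  - ((derive1 log_derive t + log_derive t ^+ 2) *+ d).
Proof.
move=> gR It; have cp := dom_chart_at S p.
rewrite ricci_rrE//; last by move=> *; exact: warped_unit.
rewrite warped_shape// -scalar_mxM mxtrace_scalar.
under eq_bigr => u _.
  rewrite (@near_derive1 _ _ log_derive); first over.
  apply: filterS (near_oitv It) => s Is.
  by rewrite warped_shape// mxE eqxx.
by rewrite sumr_const card_ord -mulNrn -mulNrn -mulrnDl opprD expr2.
Qed.

Variables (G : R -> tensor2 S) (Gh : tensor2 S).
Hypotheses (hG : is_metric_family a b G) (hGh : is_riemannian_metric Gh).

Let GR r : I r -> is_riemannian_metric (G r). Proof. exact: hG.1. Qed.

Lemma radial_massE t p c : I t -> dom c p ->
  radial_mass a b h Gh G t p =
  h t ^+ 2 * (log_derive t *+ d - \tr (radial_shape G c p t)).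
Proof.
move=> It cp; have c0p := dom_chart_at S p.
rewrite /radial_mass (warped_mean_curvature p hGh It).
rewrite (mean_curvatureE It (metric_unit (GR It) c0p)).
by rewrite (trace_radial_shape_chart hG It cp c0p).
Qed.

(** The deviation of the Weingarten map from that of the warped metric. *)
Definition conformal_defect c p t := radial_shape G c p t - (log_derive t)%:M.

(** The defect E is not symmetric, so the trace of E *m E is not a sum of squares
    of its entries; it is the squared norm of E with respect to G. *)
Definition defect_density t p :=
  let E := conformal_defect (chart_at S p) p t in h t ^+ 2 * \tr (E *m E).

(* The covariant version B of the defect E, with E = G^-1 B; it is symmetric. *)
Let defect_form c p t := 2^-1 *: radial_derive G c p t - log_derive t *: G t c p.

Let defectE c p t : I t -> dom c p ->
  conformal_defect c p t = invmx (G t c p) *m defect_form c p t.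
Proof.
move=> It cp; rewrite /conformal_defect /radial_shape (radial_derive_sym hG It cp).
rewrite mulmxBr -!scalemxAr mulVmx ?scalemx1//.
exact: metric_unit (GR It) cp.
Qed.

Let defect_form_sym c p t : I t -> dom c p ->
  (defect_form c p t)^T = defect_form c p t.
Proof.
move=> It cp; rewrite linearB /=; congr (_ - _); rewrite linearZ /=.
  by rewrite (radial_derive_sym hG It cp).
by rewrite (metric_sym (GR It) cp).
Qed.

Lemma defect_density_ge0 t p : I t -> 0 <= defect_density t p.
Proof.
move=> It; have cp := dom_chart_at S p.
apply: mulr_ge0; first exact: sqr_ge0.
rewrite defectE//; apply: mxtrace_sqr_ge0; last exact: defect_form_sym.
  exact: metric_sym (GR It) cp.
exact: metric_posdef (GR It) cp.
Qed.

Lemma defect_density_eq0 t p (c := chart_at S p) : I t -> defect_density t p = 0 ->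
  forall u v, derive1 (fun s => G s c p u v) t = 2 * log_derive t * G t c p u v.
Proof.
move=> It /eqP; have cp := dom_chart_at S p.
rewrite mulf_eq0 sqrf_eq0 (negPf (h_neq0 It)) /= defectE// => /eqP E0 u v.
have := mxtrace_sqr_eq0 (metric_sym (GR It) cp) (metric_posdef (GR It) cp)
  (defect_form_sym It cp) E0.
move=> /matrixP/(_ u v); rewrite !mxE => /eqP; rewrite subr_eq0 => /eqP H.
by rewrite -mulrA -H mulrA mulfV ?mul1r// pnatr_eq0.
Qed.

(** With k = h'/h, H = tr W and E = W - k, the derivative of h^2 (d k - H) is
    h^2 (2 k (d k - H) + d k' - H'). The traced Riccati equation replaces H' by
    - R_rr - tr W^2, and d k' by - R0_rr - d k^2; what remains besides the
    Ricci curvatures is tr W^2 - 2 k H + d k^2 = tr E^2. *)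
Lemma is_derive_radial_mass t p : I t ->
  is_derive t 1 (fun s => radial_mass a b h Gh G s p)
    (defect_density t p + weighted_ricci_diff a b h Gh G (t, p)).
Proof.
move=> It; set c := chart_at S p; have cp := dom_chart_at S p.
have dh := C1_on_derive h_C1 It.
have dk := C1_on_derive log_derive_C1 It.
have dH := derive1_trace_shape hG It cp.
set k' := derive1 log_derive t in dk; set H' := \sum_u _ in dH.
apply: (@near_eq_is_derive _ _ _ (fun s => (h s * h s) *
    (d%:R * log_derive s - \tr (radial_shape G c p s)))).
  by apply: filterS (near_oitv It) => s Is; rewrite (radial_massE Is cp) expr2 mulr_natl.
have dhh : is_derive t 1 (fun s => h s * h s) (h t * derive1 h t + h t * derive1 h t).
  exact: is_deriveM.
have dm : is_derive t 1 (fun s => d%:R * log_derive s - \tr (radial_shape G c p s))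
    (d%:R * k' - H').
  by apply: is_deriveB; exact: is_deriveZ.
have dE : is_derive t 1 (fun s => (h s * h s) *
      (d%:R * log_derive s - \tr (radial_shape G c p s)))
    ((h t * h t) * (d%:R * k' - H') +
     (d%:R * log_derive t - \tr (radial_shape G c p t)) *
       (h t * derive1 h t + h t * derive1 h t)) by exact: is_deriveM.
apply: (is_derive_eq dE).
rewrite /defect_density /weighted_ricci_diff /= -/c.
rewrite warped_ricci_rr// ricci_rrE//; last first.
  by move=> s c' q Is; exact: metric_unit (GR Is).
rewrite -/c sumrN -/H' -/k' /conformal_defect.
set W := radial_shape G c p t.
rewrite mulmxBl !mulmxBr mul_scalar_mx mul_mx_scalar -scalar_mxM.
rewrite !linearB !linearZ /= mxtrace_scalar -[_ *+ d]mulr_natl -[(_ + _) *+ d]mulr_natl.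
have h'E : derive1 h t = log_derive t * h t.
  by rewrite /log_derive divfK// h_neq0.
rewrite /GRing.scale /= h'E.
by ring.
Qed.

Lemma defect_density_continuous p : continuous_on I (defect_density ^~ p).
Proof.
have cp := dom_chart_at S p; apply: C1_on_continuous.
have EC u v : C1_on I (fun t => conformal_defect (chart_at S p) p t u v).
  apply: (fa_ext C1A (f := fun t => radial_shape G (chart_at S p) p t u v +
      (-1) * (log_derive t * (u == v)%:R))) => [t It|].
    by rewrite !mxE mulN1r mulr_natr.
  apply: (fa_add C1A (radial_shape_C1 hG u v cp)).
  apply: (fa_mul C1A (fa_cst C1A _)).
  exact: (fa_mul C1A log_derive_C1 (fa_cst C1A _)).
apply: (fa_mul C1A (f := fun t => h t ^+ 2)).
  exact: (fa_mul C1A h_C1 h_C1).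
by apply: (fa_sum C1A) => u; exact: (fa_mulmx C1A).
Qed.

Lemma weighted_ricci_continuous p :
  continuous_on I (fun t => weighted_ricci_diff a b h Gh G (t, p)).
Proof.
have cp := dom_chart_at S p; have cA := continuous_on_algebra oI (R := R).
have cW u v := C1_on_continuous (radial_shape_C1 hG u v cp).
apply: (fa_ext cA (f := fun t => h t ^+ 2 *
   ((-1) * (\sum_u (derive1 (fun t => radial_shape G (chart_at S p) p t u u) t
      + (radial_shape G (chart_at S p) p t *m radial_shape G (chart_at S p) p t) u u))
     + d%:R * (derive1 log_derive t + log_derive t * log_derive t)))).
  move=> t It; rewrite /weighted_ricci_diff /=.
  rewrite warped_ricci_rr// ricci_rrE//; last first.
    by move=> s c' q Is; exact: metric_unit (GR Is).
  by rewrite big_split /= sumrN -[_ *+ d]mulr_natl /mxtrace; congr (_ * _); ring.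
have ch := C1_on_continuous h_C1.
apply: (fa_mul cA); first exact: (fa_mul cA ch ch).
apply: (fa_add cA).
  apply: (fa_mul cA (fa_cst cA _)); apply: (fa_sum cA) => u.
  apply: (fa_add cA); last exact: (fa_mulmx cA).
  by move=> t It; have [] := radial_shape_C1 hG u u cp It.
apply: (fa_mul cA (fa_cst cA _)); apply: (fa_add cA).
  by move=> t It; have [] := log_derive_C1 It.
have ck := C1_on_continuous log_derive_C1.
exact: (fa_mul cA ck ck).
Qed.

(** Where the defect vanishes, d_r G = 2 (h'/h) G, so that G / h^2 is constant. *)
Lemma no_defect_conformal p c r s : I r -> I s -> r < s -> dom c p ->
  (forall t, r < t < s -> defect_density t p = 0) ->
  (h s ^+ 2) *: G r c p = (h r ^+ 2) *: G s c p.
Proof.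
move=> Ir Is rs cp q0; set c0 := chart_at S p.
have c0p : dom c0 p := dom_chart_at S p.
have Irs t : r <= t <= s -> I t.
  move: Ir Is; rewrite /I /oitv /= => /andP[ar _] /andP[_ sb] /andP[rt ts].
  by rewrite (lt_le_trans ar) ?lee_fin//= (le_lt_trans _ sb) ?lee_fin.
suff main u v : h s ^+ 2 * G r c0 p u v = h r ^+ 2 * G s c0 p u v.
  have key k (A J : 'M[R]_d) : k *: (J *m A *m J^T) = J *m (k *: A) *m J^T.
    by rewrite -scalemxAr -scalemxAl.
  rewrite (metric_chart (GR Ir) cp c0p) (metric_chart (GR Is) cp c0p) !key.
  by congr (_ *m _ *m _); apply/matrixP => u v; rewrite !mxE.
pose f t := G t c0 p u v * (h t * h t)^-1.
have fC1 : C1_on I f.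
  apply: (fa_mul C1A (@metric_C1 _ _ _ _ _ _ _ hG 0 c0 p u v c0p)).
  apply: (fa_inv C1A); last exact: (fa_mul C1A h_C1 h_C1).
  by move=> t It; rewrite mulf_neq0 ?h_neq0.
have df t : t \in `]r, s[ -> is_derive t 1 f 0.
  rewrite in_itv /= => rts; have It : I t.
    by apply: Irs; case/andP: rts => /ltW-> /ltW->.
  have h0 := h_neq0 It.
  have dh := C1_on_derive h_C1 It.
  have dhh : is_derive t 1 (fun s => h s * h s)
      (h t * derive1 h t + h t * derive1 h t) by exact: is_deriveM.
  have dG := C1_on_derive (@metric_C1 _ _ _ _ _ _ _ hG 0 c0 p u v c0p) It.
  have dfE : is_derive t 1 (fun s => f s * (h s * h s))
      (f t * (h t * derive1 h t + h t * derive1 h t) + h t * h t * derive1 f t).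
    by have dft := C1_on_derive fC1 It; exact: is_deriveM.
  have : derive1 (fun s => f s * (h s * h s)) t = derive1 (fun s => G s c0 p u v) t.
    apply: near_derive1; apply: filterS (near_oitv It) => x Ix.
    by rewrite /f mulfVK// mulf_neq0// h_neq0.
  rewrite derive1E derive_val (defect_density_eq0 It (q0 _ rts)) -/c0 => E.
  apply: is_derive_eq; first exact: C1_on_derive fC1 It.
  apply: (mulfI (mulf_neq0 h0 h0)); rewrite mulr0.
  move: E => /(canRL (addKr _)) ->.
  by rewrite /f /log_derive; field.
have [|x _] := MVT_segment (ltW rs) df.
  apply: derivable_within_continuous => x; rewrite in_itv /= => /Irs Ix.
  exact: (fC1 x Ix).1.
rewrite mul0r => /eqP; rewrite subr_eq0 => /eqP fE.
have hs := h_neq0 Is; have hr := h_neq0 Ir; move: fE; rewrite /f => fE.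
have -> : G s c0 p u v = G s c0 p u v / (h s * h s) * (h s * h s).
  by rewrite mulfVK ?mulf_neq0.
by rewrite fE; field.
Qed.

End Monotonicity.

(** * Integration of a pointwise monotonicity formula *)

Section IntegratedMonotonicity.
Context {dX : measure_display} {X : measurableType dX} {R : realType}.
Variable mu : {finite_measure set X -> \bar R}.
Variables (a b : \bar R) (m q w : R -> X -> R).

Let I := oitv a b.
Let leb : {sigma_finite_measure set (measurableTypeR R) -> \bar R} :=
  lebesgue_measure.
Let D := [set z : measurableTypeR R * X | (a < (z.1)%:E < b)%E].
Let W (z : measurableTypeR R * X) : \bar R := (w z.1 z.2)%:E.

Hypothesis m_deriv : forall p t, I t -> is_derive t 1 (m ^~ p) (q t p + w t p).
Hypothesis q_ge0 : forall p t, I t -> 0 <= q t p.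
Hypothesis q_cont : forall p, continuous_on I (q ^~ p).
Hypothesis w_cont : forall p, continuous_on I (w ^~ p).
Hypothesis m_int : forall t, I t -> mu.-integrable setT (EFin \o m t).
Hypothesis w_int : (leb \x mu)%E.-integrable D W.

Lemma itv_sub_oitv r s : I r -> I s -> `[r, s] `<=` I.
Proof.
move=> /andP[ar _] /andP[_ sb] t /=; rewrite in_itv /= => /andP[rt ts].
by apply/andP; rewrite (lt_le_trans ar) ?lee_fin//= (le_lt_trans _ sb) ?lee_fin.
Qed.

Let within_itv (f : R -> R) r s : I r -> I s -> continuous_on I f ->
  {within `[r, s], continuous f}.
Proof.
move=> Ir Is cf; apply: continuous_in_subspaceT => t /set_mem tI.
exact: cf (itv_sub_oitv Ir Is tI).
Qed.

Let itv_integrable (f : R -> R) r s : I r -> I s -> continuous_on I f ->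
  leb.-integrable `[r, s] (EFin \o f).
Proof.
move=> Ir Is cf; apply: continuous_compact_integrable; first exact: segment_compact.
exact: within_itv.
Qed.

(** The defect is integrated in r first, at a fixed point p: the fundamental theorem
    of calculus makes the result a difference of functions of p that are known to be
    integrable on X. *)
Definition defect r s p := (\int[leb]_(t in `[r, s]) (q t p)%:E)%E.

Lemma defect_ge0 r s p : I r -> I s -> (0 <= defect r s p)%E.
Proof.
move=> Ir Is; apply: integral_ge0 => t tI; rewrite lee_fin.
exact: q_ge0 (itv_sub_oitv Ir Is tI).
Qed.

Lemma defect_sub r s r' s' p : I r' -> I s' -> r' <= r -> s <= s' ->
  (defect r s p <= defect r' s' p)%E.
Proof.
move=> Ir Is rr ss; apply: ge0_subset_integral => //.
- by have /integrableP[] := itv_integrable Ir Is (@q_cont p).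
- by move=> t tI; rewrite lee_fin; exact: q_ge0 (itv_sub_oitv Ir Is tI).
- move=> t /=; rewrite !in_itv /= => /andP[rt ts].
  by rewrite (le_trans rr)// (le_trans ts).
Qed.

Lemma defect_ftc r s p : I r -> I s -> r < s ->
  defect r s p =
  ((m s p)%:E - (m r p)%:E - \int[leb]_(t in `[r, s]) (w t p)%:E)%E.
Proof.
move=> Ir Is rs; have sub := itv_sub_oitv Ir Is.
have dm t : t \in `[r, s] -> derivable (m ^~ p) t 1.
  by move=> /sub It; have := @m_deriv p t It => ?; exact: ex_derive.
have mC : continuous_on I (m ^~ p).
  move=> t It; have := @m_deriv p t It => ?.
  by apply/differentiable_continuous/derivable1_diffP; exact: ex_derive.
have iw := itv_integrable Ir Is (@w_cont p).
have iq := itv_integrable Ir Is (@q_cont p).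
have := @continuous_FTC2 R (fun t => q t p + w t p) (m ^~ p) r s rs.
move=> /(_ _ _ _) FTC; rewrite -FTC; first last.
- move=> t; rewrite in_itv /= => /andP[rt ts]; rewrite derive1E.
  have It : I t by apply: sub; rewrite /= in_itv /= !ltW.
  by have := @m_deriv p t It => ?; rewrite derive_val.
- split.
  + move=> t; rewrite in_itv /= => /andP[rt ts].
    by apply: dm; rewrite in_itv /= !ltW.
  + by apply: cvg_at_right_filter; exact: mC.
  + by apply: cvg_at_left_filter; exact: mC.
- apply: within_itv => // t It.
  by apply: cvgD; [exact: q_cont | exact: w_cont].
under eq_integral do rewrite EFinD.
rewrite integralD//= addeK//; exact: integrable_fin_num.
Qed.

Lemma measurable_strip (i : set (measurableTypeR R)) : measurable i ->
  measurable [set z : measurableTypeR R * X | i z.1].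
Proof.
move=> mi; rewrite (_ : [set _ | _] = i `*` setT).
  exact: measurableX.
by apply/seteqP; split=> z //= [].
Qed.

Lemma measurable_oitv : measurable (I : set (measurableTypeR R)).
Proof. by apply: measurable_realfun.open_measurable; exact: open_oitv. Qed.

Let mD : measurable D. Proof. exact: measurable_strip measurable_oitv. Qed.

Let strip r s := [set z : measurableTypeR R * X | z.1 \in `[r, s]].

Let mstrip r s : measurable (strip r s).
Proof. by apply: (@measurable_strip [set` `[r, s]]). Qed.

Let strip_sub r s : I r -> I s -> strip r s `<=` D.
Proof. by move=> Ir Is z /(itv_sub_oitv Ir Is). Qed.

Let wstrip r s : I r -> I s ->
  (leb \x mu)%E.-integrable (strip r s) W.
Proof.
move=> Ir Is.
exact: (integrableS mD (mstrip r s) (strip_sub Ir Is) w_int).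
Qed.

Let wint r s (p : X) : \bar R := (\int[leb]_(t in `[r, s]) (w t p)%:E)%E.

Lemma strip_fubini r s : I r -> I s ->
  mu.-integrable setT (wint r s) /\
  (\int[mu]_p wint r s p =
   \int[leb \x mu]_(z in strip r s) W z)%E.
Proof.
move=> Ir Is.
have iw : (leb \x mu)%E.-integrable setT (W \_ (strip r s)).
  by apply/(integrable_mkcond _ (mstrip r s)); exact: wstrip.
have GE (p : X) : fubini_G leb (W \_ (strip r s)) p = wint r s p.
  rewrite /wint /fubini_G [RHS]integral_mkcond; apply: eq_integral => t _.
  by rewrite /patch /strip !mem_setE.
split; last first.
  rewrite [RHS]integral_mkcond -(integral21_prod_meas1 iw).
  by apply: eq_integral => p _; rewrite GE.
have mG : measurable_fun setT (wint r s).
  have := measurable_fubini_G iw.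
  by congr (measurable_fun _ _); apply/funext => p; rewrite GE.
apply/integrableP; split => //.
have /integrableP[mw fw] := iw.
apply: le_lt_trans fw; rewrite (fubini_tonelli2 (fun z => `|(W \_ (strip r s)) z|%E))//.
  apply: ge0_le_integral => //.
  - exact: measurableT_comp.
  - apply: measurable_fun_fubini_tonelli_G => //; exact: measurableT_comp.
  - move=> p _; rewrite -GE; apply: le_abse_integral => //.
    exact: measurableT_comp mw _.
exact: measurableT_comp.
Qed.

Definition mass t := \int[mu]_p m t p.

Let gain r s := (\int[leb \x mu]_(z in strip r s) W z)%E.

Lemma integral_defect r s : I r -> I s -> r < s ->
  mu.-integrable setT (defect r s) /\
  (\int[mu]_p defect r s p = (mass s)%:E - (mass r)%:E - gain r s)%E.
Proof.
move=> Ir Is rs; have [iw wE] := strip_fubini Ir Is.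
have im := integrableB measurableT (m_int Is) (m_int Ir).
have dE : defect r s = (fun p => (m s p)%:E - (m r p)%:E - wint r s p)%E.
  by apply/funext => p; exact: defect_ftc.
have massE t : I t -> (\int[mu]_p (m t p)%:E = (mass t)%:E)%E.
  by move=> It; rewrite /mass /Rintegral fineK//; exact: integrable_fin_num (m_int It).
rewrite dE; split; first exact: (integrableB measurableT im iw).
rewrite (integralB measurableT im iw) (integralB measurableT (m_int Is) (m_int Ir)).
by rewrite wE !massE.
Qed.

Hypothesis ab : (a < b)%E.
Variables Ma Mb : R.
Hypothesis mass_a : mass t @[t --> nbhs_in a b a] --> Ma.
Hypothesis mass_b : mass t @[t --> nbhs_in a b b] --> Mb.

Let total := (\int[leb \x mu]_(z in D) W z)%E.

Let total_fin : total \is a fin_num.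
Proof. exact: integrable_fin_num. Qed.

Let near_lt (u : nat -> R) t : (u n)%:E @[n --> \oo] --> a -> I t ->
  \forall n \near \oo, u n < t.
Proof.
move=> ua /andP[at_ _]; have := ua [set x | (x < t%:E)%E].
case; first by apply: open_nbhs_nbhs; split=> //; exact: open_ereal_lt_ereal.
by move=> n0 _ nP; exists n0 => // n /nP /=; rewrite lte_fin.
Qed.

Let near_gt (u : nat -> R) t : (u n)%:E @[n --> \oo] --> b -> I t ->
  \forall n \near \oo, t < u n.
Proof.
move=> ub /andP[_ tb]; have := ub [set x | (t%:E < x)%E].
case; first by apply: open_nbhs_nbhs; split=> //; exact: open_ereal_gt_ereal.
by move=> n0 _ nP; exists n0 => // n /nP /=; rewrite lte_fin.
Qed.

(** The strips exhaust the product, and the integral of the defect over them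
    increases; its limit is computed from the other terms. *)
Lemma integral_defect_le r s : I r -> I s -> r < s ->
  (\int[mu]_p defect r s p <= Mb%:E - Ma%:E - total)%E.
Proof.
move=> Ir Is rs.
have [u Iu ua] := cvg_left_end ab; have [v Iv vb] := cvg_right_end ab.
have /integrableP[mW _] := w_int.
have gain_cvg : gain (u n) (v n) @[n --> \oo] --> total.
  have mWn n : measurable_fun D (W \_ (strip (u n) (v n))).
    apply/(measurable_restrict _ (mstrip (u n) (v n)) mD).
    by apply: measurable_funS mW => // z [].
  have WnW : {ae (leb \x mu)%E, forall z, D z ->
      (W \_ (strip (u n) (v n))) z @[n --> \oo] --> W z}.
    apply: aeW => z Dz; apply: cvg_near_cst.
    have near_u := near_lt ua Dz; have near_v := near_gt vb Dz.
    near=> n; rewrite /patch ifT//; apply/mem_set; rewrite /strip /= in_itv /=.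
    by apply/andP; split; apply: ltW; near: n.
  have leW : {ae (leb \x mu)%E, forall z n, D z ->
      (`|(W \_ (strip (u n) (v n))) z| <= `|W z|)%E}.
    apply: aeW => z n _; rewrite /patch; case: ifP => // _.
    by rewrite abse0.
  have [_ _] := dominated_convergence mD mWn mW WnW (integrable_abse w_int) leW.
  apply: cvg_trans; apply: near_eq_cvg; near=> n.
  rewrite /gain -[X in integral _ X _](setIidr (strip_sub (Iu n) (Iv n))).
  by rewrite integral_mkcondr.
have cvgJ : ((mass (v n))%:E - (mass (u n))%:E - gain (u n) (v n))%E @[n --> \oo]
    --> (Mb%:E - Ma%:E - total)%E.
  apply: cvgeB gain_cvg; first exact: fin_num_adde_defr.
  apply: cvgeB => //.
    by apply: cvg_EFin; [near=> n | exact: cvg_comp (cvg_nbhs_in Iv vb) mass_b].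
  by apply: cvg_EFin; [near=> n | exact: cvg_comp (cvg_nbhs_in Iu ua) mass_a].
apply: cvge_ge cvgJ.
have near_u := near_lt ua Ir; have near_v := near_gt vb Is.
near=> n.
have ur : u n < r by near: n.
have sv : s < v n by near: n.
have uv : u n < v n := lt_trans ur (lt_trans rs sv).
have [iuv <-] := integral_defect (Iu n) (Iv n) uv.
have [irs _] := integral_defect Ir Is rs.
apply: le_integral => // p _.
exact: (defect_sub _ (Iu n) (Iv n) (ltW ur) (ltW sv)).
Unshelve. all: by end_near. Qed.

Lemma mass_le : (Ma%:E + total <= Mb%:E)%E.
Proof.
have [s Is] := oitv_ex ab; have [u Iu ua] := cvg_left_end ab.
have [n _ /(_ n (leqnn n)) /= us] := near_lt ua Is.
have := integral_defect_le (Iu n) Is us.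
rewrite -(fineK total_fin) -!EFinB -EFinD => /(le_trans _) H.
have := H 0%E; rewrite integral_ge0; last by move=> p _; exact: (defect_ge0 p (Iu n) Is).
by move=> /(_ isT); rewrite !lee_fin; lra.
Qed.

Let defect_eq0 r s p : I r -> I s -> defect r s p = 0%E ->
  forall t, r < t < s -> q t p = 0.
Proof.
move=> Ir Is q0 t /andP[rt ts].
have It : I t by apply: (itv_sub_oitv Ir Is); rewrite /= in_itv /= !ltW.
apply/eqP; rewrite eq_le q_ge0// andbT leNgt; apply/negP => qt0.
have qt2 : q t p / 2 < q t p by lra.
have near_q : \forall x \near t, q t p / 2 < q x p.
  exact: cvgr_gt (q t p) (@q_cont p t It) (q t p / 2) qt2.
have [e /= e0 qe] := (nbhs_ballP _ _).1 near_q.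
(* q is at least q t p / 2 on [t, t + e'], a subinterval of [r, s]. *)
pose e' := Num.min (e / 2) (s - t).
have e'0 : 0 < e' by rewrite lt_min divr_gt0// subr_gt0.
have te's : t + e' <= s by rewrite -lerBrDl ge_min lexx orbT.
have Ite : I (t + e').
  by apply: (itv_sub_oitv Ir Is); rewrite /= in_itv /= te's (le_trans (ltW rt))// lerDl ltW.
have := @defect_sub t (t + e') r s p Ir Is (ltW rt) te's.
rewrite q0 leNgt => /negP; apply.
have low_gt0 : (0 < \int[leb]_(x in `[t, (t + e')%R]) (cst (q t p / 2)%:E x))%E.
  have lebE : leb [set` `[t, t + e']] = e'%:E.
    have := @lebesgue_measure_itv R `[t, t + e'].
    by rewrite /= lte_fin ltrDl e'0 -EFinB (addrC t) addrK.
  rewrite integral_cst// [X in (_ < _ * X)%E](_ : _ = e'%:E); last exact: lebE.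
  by rewrite -EFinM lte_fin mulr_gt0 ?divr_gt0.
apply: (lt_le_trans low_gt0); apply: ge0_le_integral => //.
- by move=> x _; rewrite lee_fin; lra.
- by have /integrableP[] := itv_integrable It Ite (@q_cont p).
- move=> x /=; rewrite in_itv /= => /andP[tx xt]; rewrite lee_fin ltW//; apply: qe.
  rewrite /ball /= distrC ger0_norm ?subr_ge0//.
  have : e' <= e / 2 by rewrite ge_min lexx.
  by lra.
Qed.

(** In the equality case the nonnegative defect has integral zero over X. *)
Lemma mass_eq_defect r s : I r -> I s -> r < s -> (Mb%:E <= Ma%:E + total)%E ->
  {ae mu, forall p, forall t, r < t < s -> q t p = 0}.
Proof.
move=> Ir Is rs MbMa; have [irs _] := integral_defect Ir Is rs.
have /integrableP[md _] := irs.
have : (\int[mu]_p `|defect r s p| = 0)%E.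
  under eq_integral do rewrite gee0_abs ?(defect_ge0 _ Ir Is)//.
  apply/eqP; rewrite eq_le integral_ge0 ?andbT; last first.
    by move=> p _; exact: (defect_ge0 p Ir Is).
  apply: le_trans (integral_defect_le Ir Is rs) _.
  move: MbMa; rewrite -(fineK total_fin) -!EFinB -EFinD !lee_fin; lra.
move=> /(ae_eq_integral_abs mu measurableT md).
by apply: filterS => p /(_ Logic.I) /= /(defect_eq0 Ir Is).
Qed.

End IntegratedMonotonicity.

(** * The Riemannian measure: finiteness and positivity *)

Section IteratedIntegral.
Context {R : realType}.

(** The integral of a nonnegative function is a supremum over simple functions
    below it, so it is monotone without measurability. Iterated integrals can
    therefore be compared with those of multiples of indicators of boxes although
    their inner integrals are not known to be measurable. *)
Lemma le_integral_ge0 {dT : measure_display} {T : measurableType dT}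
    (mu : {measure set T -> \bar R}) (f g : T -> \bar R) :
  (forall x, 0 <= f x)%E -> (forall x, f x <= g x)%E ->
  (\int[mu]_x f x <= \int[mu]_x g x)%E.
Proof.
move=> f0 fg; have g0 x : (0 <= g x)%E := le_trans (f0 x) (fg x).
rewrite !ge0_integralTE//; apply: ereal_sup_le => _ [k /= kf <-].
by exists k => //= x; exact: le_trans (kf x) (fg x).
Qed.

Lemma iterated_integral_ge0 m (f : 'rV[R]_m -> \bar R) :
  (forall x, 0 <= f x)%E -> (0 <= iterated_integral f)%E.
Proof.
elim: m f => [|m IHm] f f0 /=; first exact: f0.
by apply: integral_ge0 => t _; apply: IHm => x; exact: f0.
Qed.

Let integral_box (c e s : R) : 0 < e -> 0 <= c ->
  (\int[lebesgue_measure]_t (c * \1_([set` `[s, s + e]%R]) t)%:E = (c * e)%:E)%E.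
Proof.
move=> e0 c0; under eq_integral do rewrite EFinM.
rewrite ge0_integralZl_EFin//; last first.
  by apply/measurable_EFinP; exact: measurable_indic.
rewrite integral_indic// setIT EFinM; congr (_ * _)%E.
have := @lebesgue_measure_itv R `[s, s + e].
by rewrite /= lte_fin ltrDl e0 -EFinB (addrC s) addrK.
Qed.

(** The box has x0 as its lowest corner: if x0 lies in the half-space, so does the
    box, also when x0 is on the boundary. *)
Lemma iterated_integral_ge m (f : 'rV[R]_m -> \bar R) (x0 : 'rV[R]_m) (c e : R) :
  0 < e -> 0 <= c -> (forall x, 0 <= f x)%E ->
  (forall x : 'rV[R]_m, (forall i, x0 ord0 i <= x ord0 i <= x0 ord0 i + e) -> (c%:E <= f x)%E) ->
  ((c * e ^+ m)%:E <= iterated_integral f)%E.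
Proof.
move=> e0; elim: m f x0 c => [|m IHm] f x0 c c0 f0 fc /=.
  by rewrite expr0 mulr1; apply: fc => -[].
move: x0 fc; rewrite -[m.+1]/(1 + m)%N => x0 fc.
rewrite exprSr mulrA -(@integral_box _ _ (x0 ord0 (@radial m))) ?mulr_ge0 ?exprn_ge0 ?(ltW e0)//.
apply: le_integral_ge0 => t.
  by rewrite lee_fin !mulr_ge0 ?exprn_ge0// ltW.
have [tb|tb] := boolP (t \in `[x0 ord0 (@radial m), x0 ord0 (@radial m) + e]); last first.
  rewrite indicE memNset ?mulr0; last exact/negP.
  by apply: iterated_integral_ge0 => x; exact: f0.
rewrite indicE mem_set// mulr1; apply: (IHm _ (rsubmx x0)) => // x xb.
apply: fc => i; have [k ->|k ->] := split_ordP i.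
  by rewrite row_mxEl mxE [k]ord1 eqxx.
by rewrite row_mxEr; have := xb k; rewrite mxE.
Qed.

Lemma iterated_integral_le m (f : 'rV[R]_m -> \bar R) (x0 : 'rV[R]_m) (c e : R) :
  0 < e -> 0 <= c -> (forall x, 0 <= f x <= c%:E)%E ->
  (forall (x : 'rV[R]_m) i, ~~ (x0 ord0 i <= x ord0 i <= x0 ord0 i + e) -> f x = 0%E) ->
  (iterated_integral f <= (c * e ^+ m)%:E)%E.
Proof.
move=> e0; elim: m f x0 c => [|m IHm] f x0 c c0 fc f0 /=.
  by rewrite expr0 mulr1; case/andP: (fc 0).
move: x0 f0; rewrite -[m.+1]/(1 + m)%N => x0 f0.
rewrite exprSr mulrA -(@integral_box _ _ (x0 ord0 (@radial m))) ?mulr_ge0 ?exprn_ge0 ?(ltW e0)//.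
apply: le_integral_ge0 => t.
  by apply: iterated_integral_ge0 => x; case/andP: (fc (row_mx t%:M x)).
have sub0 (x : 'rV[R]_m) i : ~~ (rsubmx x0 ord0 i <= x ord0 i <= rsubmx x0 ord0 i + e) ->
    f (row_mx (t%:M : 'rV[R]_1) x) = 0%E.
  by rewrite mxE => xb; apply: (f0 _ (rshift 1 i)); rewrite row_mxEr.
have [tb|tb] := boolP (t \in `[x0 ord0 (@radial m), x0 ord0 (@radial m) + e]).
  by rewrite indicE mem_set// mulr1; apply: (IHm _ (rsubmx x0)).
rewrite indicE memNset ?mulr0; last exact/negP.
rewrite -(mul0r (e ^+ m)); apply: (IHm _ (rsubmx x0)) => // x.
rewrite (f0 _ (@radial m)) ?lexx// radial_ptE0.
by move: tb; rewrite in_itv.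
Qed.

End IteratedIntegral.

Section RiemannianMeasure.
Context {R : realType} {d : nat} {N : ptopologicalType}.
Variable S : smooth_structure R d N.
Variables (Gh : tensor2 S) (hGh : is_riemannian_metric Gh).
Variable mu : {measure set (g_sigma_algebraType (@open N)) -> \bar R}.
Hypothesis hmu : is_riemannian_measure Gh mu.

Lemma open_measurable_borel (U : set N) : open U ->
  measurable (U : set (g_sigma_algebraType (@open N))).
Proof. by move=> oU; exact: sub_sigma_algebra. Qed.

Let density c (U : set N) x : \bar R :=
  (\1_(coord c @` U) x * Num.sqrt (\det (Gh c (param c x))))%:E.

Let density_ge0 c U x : (0 <= density c U x)%E.
Proof. by rewrite lee_fin mulr_ge0 ?sqrtr_ge0// indicE ler0n. Qed.

Lemma metric_continuous_at (g : tensor2 S) c u v : is_riemannian_metric g ->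
  continuous_on (dom c) (fun p => g c p u v).
Proof.
move=> [_ _ _ sg] p cp; have [V [F [oV Vp CF FE]]] :=
  sg c u v (coord c p) (ex_intro2 _ _ p cp erefl).
have : {for p, continuous (fun q => F (coord c q))}.
  apply: (@continuous_comp _ _ _ (coord c)); first exact: coord_continuous.
  by have [+ _] := CF 0%N; apply.
have ncp := open_nbhs_nbhs (conj (dom_open c) cp).
have nV : \forall q \near p, V (coord c q).
  exact: coord_continuous cp _ (open_nbhs_nbhs (conj oV Vp)).
apply: near_continuous; near=> q.
have cq : dom c q by near: q.
by rewrite FE ?coordK//; [exists q | near: q].
Unshelve. all: by end_near. Qed.

Let det_cont c : continuous_on (dom c) (fun p => \det (Gh c p)).
Proof.
apply: (fa_det (continuous_on_algebra (dom_open c))) => i j.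
exact: metric_continuous_at.
Qed.

(** Near a point p, the density is bounded below by a positive constant, and the
    image of the open set in a chart contains a box with corner at p. *)
Lemma riemannian_measure_gt0 (U : set N) : open U -> U !=set0 -> (0 < mu U)%E.
Proof.
move=> oU [p Up]; set c := chart_at S p; have cp : dom c p := dom_chart_at S p.
pose k := \det (Gh c p) / 2.
have k0 : 0 < k by rewrite divr_gt0//; exact: metric_det_gt0.
pose U' := (U `&` dom c `&` [set q | k < \det (Gh c q)])°.
have U'p : U' p.
  apply: filterI; last first.
    apply: (cvgr_gt (\det (Gh c p)) (@det_cont c p cp)).
    by rewrite /k; have := metric_det_gt0 hGh cp; lra.
  by apply: filterI; apply: open_nbhs_nbhs; split=> //; exact: dom_open.
have oU' : open U' by exact: open_interior.
have subU' := @interior_subset _ (U `&` dom c `&` [set q | k < \det (Gh c q)]).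
have U'c : U' `<=` dom c by move=> q /subU'[[]].
apply: (@lt_le_trans _ _ (mu U')); last first.
  apply: le_measure; [exact: mem_set (open_measurable_borel oU')|
    exact: mem_set (open_measurable_borel oU)|].
  by move=> q /subU'[[]].
rewrite (hmu (open_measurable_borel oU') U'c) -/(density c U').
have [W oW WE] := coord_open oU' U'c.
have [Wp Hp] : (W `&` @half_space R d) (coord c p) by rewrite -WE; exists p.
have /nbhs_ballP[e /= e0 eW] := open_nbhs_nbhs (conj oW Wp).
have e20 : 0 < e / 2 by rewrite divr_gt0.
apply: lt_le_trans (@iterated_integral_ge _ _ _ (coord c p) (Num.sqrt k) (e / 2) _ _ _ _).
- by rewrite lte_fin mulr_gt0 ?sqrtr_gt0// exprn_gt0.
- by [].
- exact: sqrtr_ge0.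
- by move=> x; exact: density_ge0.
move=> x xb.
have : (W `&` @half_space R d) x.
  split.
    apply: eW; split=> // i j; rewrite /ball /= [i]ord1 distrC ger0_norm ?subr_ge0.
      by have /andP[_] := xb j; lra.
    by have /andP[] := xb j.
  move=> j j0; apply: le_trans (Hp j j0) _.
  by have /andP[] := xb j.
rewrite -WE => -[q U'q qx].
rewrite /density lee_fin indicE mem_set; last by exists q.
rewrite mul1r -qx coordK; last exact: U'c.
by apply: ler_wsqrtr; apply: ltW; have /subU'[_] := U'q.
Qed.

(** Near a point, the density is bounded and the coordinates stay in a box. *)
Lemma riemannian_measure_loc_fin (p : N) :
  exists U : set N, [/\ open U, U p & (mu U < +oo)%E].
Proof.
set c := chart_at S p; have cp : dom c p := dom_chart_at S p.
pose k := \det (Gh c p) + 1.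
pose box := [set q | forall j, coord c p ord0 j - 1 < coord c q ord0 j < coord c p ord0 j + 1].
pose V := dom c `&` box `&` [set q | \det (Gh c q) < k].
pose U' := V°.
have coordj j : {for p, continuous (fun q => coord c q ord0 j)}.
  apply: (@continuous_comp _ _ _ (coord c) (fun M : 'rV[R]_d => M ord0 j)).
    exact: coord_continuous.
  exact: matrix_normedtype.coord_continuous.
have U'p : U' p.
  apply: filterI; last first.
    apply: (cvgr_lt (\det (Gh c p)) (@det_cont c p cp)).
    by rewrite /k; lra.
  apply: filterI; first by apply: open_nbhs_nbhs; split=> //; exact: dom_open.
  apply: filter_forall => j; near=> q; apply/andP; split.
    by near: q; apply: (cvgr_gt (coord c p ord0 j) (coordj j)); lra.
  by near: q; apply: (cvgr_lt (coord c p ord0 j) (coordj j)); lra.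
have oU' : open U' by exact: open_interior.
have subU' := @interior_subset _ V.
have U'c : U' `<=` dom c by move=> q /subU'[[]].
exists U'; split=> //.
rewrite (hmu (open_measurable_borel oU') U'c) -/(density c U').
have k0 : 0 <= k by rewrite addr_ge0// ltW// metric_det_gt0.
apply: le_lt_trans (ltry (Num.sqrt k * 2 ^+ d)).
apply: (@iterated_integral_le _ _ _ (\row_j (coord c p ord0 j - 1))) => //.
- move=> x; rewrite density_ge0 /density lee_fin indicE.
  case: (boolP (x \in _)) => [/set_mem[q U'q <-]|_]; last first.
    by rewrite mul0r sqrtr_ge0.
  rewrite mul1r coordK; last exact: U'c.
  by apply: ler_wsqrtr; apply: ltW; have /subU'[_] := U'q.
- move=> x j xb; rewrite /density indicE memNset ?mul0r// => -[q U'q qx].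
  move/negP: xb; apply; rewrite !mxE -qx.
  by have /subU'[[_ /(_ j)/andP[lb ub] _]] := U'q; apply/andP; split; lra.
Unshelve. all: by end_near. Qed.

Lemma riemannian_measure_fin : compact [set: N] -> (mu setT < +oo)%E.
Proof.
rewrite compact_cover => Ncov.
pose fin_open (U : set N) := open U /\ (mu U < +oo)%E.
have [F Ffin Fcov] : finite_subset_cover fin_open id [set: N].
  apply: Ncov; first by move=> U [].
  by move=> p _; have [U [oU Up Ufin]] := riemannian_measure_loc_fin p; exists U.
have : (mu setT <= \sum_(U \in [set` F]) mu U)%E.
  apply: content_sub_fsum => // U UF.
  by have /set_mem[/open_measurable_borel] := Ffin _ UF.
move=> /le_lt_trans; apply; rewrite fsbig_finite//= set_fsetK.
rewrite big_seq; apply: lte_sum_pinfty => U UF.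
by have /set_mem[] := Ffin _ UF.
Qed.

End RiemannianMeasure.

(** * Rescaled metrics *)

Section Scaling.
Context {R : realType}.

Lemma Ck_on_ext m k (V : set 'rV[R]_m) (f g : 'rV[R]_m -> R) : open V ->
  (forall x, V x -> f x = g x) -> Ck_on k V f -> Ck_on k V g.
Proof.
move=> oV; elim: k f g => [|k IHk] f g fg /= [cf df].
  split=> // x Vx; apply: near_continuous (cf x Vx).
  by apply: filterS (open_nbhs_nbhs (conj oV Vx)) => y; exact: fg.
have nfg x : V x -> \near x, f x = g x.
  by move=> Vx; apply: filterS (open_nbhs_nbhs (conj oV Vx)) => y; exact: fg.
split=> [x Vx|i]; first exact: near_continuous (nfg x Vx) (cf x Vx).
have [dfi Cfi] := df i; split=> [x Vx|].
  exact: near_eq_derivable (nfg x Vx) (dfi x Vx).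
by apply: IHk Cfi => x Vx; apply: near_eq_derive; exact: nfg.
Qed.

Lemma Ck_on_scale m k (V : set 'rV[R]_m) (f : 'rV[R]_m -> R) l : open V ->
  Ck_on k V f -> Ck_on k V (fun x => l * f x).
Proof.
move=> oV; have cA := continuous_on_algebra oV (R := R).
elim: k f => [|k IHk] f /= [cf df].
  by split=> //; exact: (fa_mul cA (fa_cst cA l) cf).
split=> [|i]; first exact: (fa_mul cA (fa_cst cA l) cf).
have [dfi Cfi] := df i; split=> [x Vx|].
  exact: derivableZ (dfi x Vx).
apply: Ck_on_ext (IHk _ Cfi) => // x Vx.
by have := deriveZ l (dfi x Vx).
Qed.

Lemma metric_scale d (N : ptopologicalType) (S : smooth_structure R d N)
    (g : tensor2 S) (l : R) : 0 < l -> is_riemannian_metric g ->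
  is_riemannian_metric (fun c p => l *: g c p).
Proof.
move=> l0 gR; split.
- by move=> c p cp; rewrite linearZ /= (metric_sym gR cp).
- move=> c p v cp v0; rewrite -scalemxAr -scalemxAl mxE.
  by rewrite mulr_gt0//; exact: metric_posdef gR cp v v0.
- move=> c c' p cp c'p; rewrite -scalemxAr -scalemxAl.
  by rewrite -(metric_chart gR cp c'p).
- have [_ _ _ sg] := gR; move=> c i j x cx.
  have [V [F [oV Vx CF FE]]] := sg c i j x cx.
  exists V, (fun x => l * F x); split=> // [k|y cy Vy].
    exact: Ck_on_scale.
  by rewrite mxE FE.
Qed.

End Scaling.

(** * Continuous functions on a compact space *)

Section ContinuousBorel.
Context {R : realType} {N : ptopologicalType}.

Lemma continuous_borel (f : N -> R) : continuous f ->
  measurable_fun setT (f : g_sigma_algebraType (@open N) -> R).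
Proof.
move=> cf; apply: (measurability _ (RGenOInfty.measurableE R)).
move=> _ [_ [x ->] <-]; rewrite setTI.
apply: sub_sigma_algebra; apply: (@open_comp N R f) => [p _|]; first exact: cf.
exact: interval_open.
Qed.

Lemma continuous_compact_bounded (f : N -> R) : compact [set: N] ->
  continuous f -> exists M : R, forall p, `|f p| <= M.
Proof.
move=> cN cf.
have : compact (f @` [set: N]).
  by apply: continuous_compact cN; exact: continuous_subspaceT.
move=> /compact_bounded[M [_ fM]]; exists (M + 1) => p.
by apply: fM; [rewrite ltrDl | exists p].
Qed.

Lemma continuous_integrable (mu : {measure set (g_sigma_algebraType (@open N)) -> \bar R})
    (f : N -> R) : compact [set: N] -> (mu setT < +oo)%E -> continuous f ->
  mu.-integrable setT (EFin \o (f : g_sigma_algebraType (@open N) -> R)).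
Proof.
move=> cN mufin cf; have [M fM] := continuous_compact_bounded cN cf.
apply: measurable_bounded_integrable => //; first exact: continuous_borel.
exists M; split; first exact: num_real.
by move=> x Mx p _; exact: le_trans (fM p) (ltW Mx).
Qed.

End ContinuousBorel.

(** * Rigidity in the case of equality *)

Section FiniteVersion.
Context {dT : measure_display} {T : measurableType dT} {R : realType}.
Variables (mu : {measure set T -> \bar R}) (mu_fin : fin_num_fun mu).

(** The same set function, which carries the structure of a finite measure once a
    proof of finiteness is supplied. *)
Definition finite_version (_ : fin_num_fun mu) : set T -> \bar R := mu.

HB.instance Definition _ := isMeasure.Build _ _ _ (finite_version mu_fin)
  (measure0 mu) (measure_ge0 mu) (@measure_semi_sigma_additive _ _ _ mu).

HB.instance Definition _ :=
  Measure_isFinite.Build _ _ _ (finite_version mu_fin) mu_fin.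

End FiniteVersion.

Section Rigidity.
Context {R : realType} {d : nat} {N : ptopologicalType}.
Variable S : smooth_structure R d N.
Hypothesis N_compact : compact [set: N].
Variables a b : \bar R.
Hypothesis ab : (a < b)%E.
Variable G : R -> tensor2 S.
Hypothesis hG : is_metric_family a b G.
Variable h : R -> R.
Hypotheses (h_smooth : smooth_on_itv a b h)
           (h_pos : forall r : R, (a < r%:E < b)%E -> 0 < h r).
Variable Gh : tensor2 S.
Hypothesis hGh : is_riemannian_metric Gh.
Variable mu : {measure set (g_sigma_algebraType (@open N)) -> \bar R}.
Hypothesis hmu : is_riemannian_measure Gh mu.

Let I := oitv a b.

Lemma radial_mass_continuous r : I r -> continuous (radial_mass a b h Gh G r).
Proof.
move=> Ir; have cH := continuous_mean_curvature hG Ir.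
rewrite (_ : radial_mass a b h Gh G r = fun p =>
    h r ^+ 2 * (log_derive h r *+ d - mean_curvature a b G r p)).
  move=> p; apply: cvgM; first exact: cvg_cst.
  by apply: cvgB; [exact: cvg_cst | exact: cH].
by apply/funext => p; rewrite /radial_mass (warped_mean_curvature h_smooth h_pos).
Qed.

(** At fixed radii both sides are continuous in p, and a negligible set contains no
    nonempty open set. *)
Lemma dense_conformal r s : I r -> I s ->
  {ae mu, forall p, forall c, dom c p ->
     h s ^+ 2 *: G r c p = h r ^+ 2 *: G s c p} ->
  forall c p, dom c p -> h s ^+ 2 *: G r c p = h r ^+ 2 *: G s c p.
Proof.
move=> Ir Is [Z [mZ Z0 subZ]] c p cp; apply/matrixP => u v; rewrite !mxE.
apply/eqP; rewrite -subr_eq0; apply/negPn/negP => fp.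
pose f q := h s ^+ 2 * G r c q u v - h r ^+ 2 * G s c q u v.
have cA := continuous_on_algebra (dom_open c) (R := R).
have cf : continuous_on (dom c) f.
  apply: (fa_ext cA (f := fun q => h s ^+ 2 * G r c q u v
      + (- h r ^+ 2) * G s c q u v)) => [q _|]; first by rewrite mulNr.
  apply: (fa_add cA); apply: (fa_mul cA (fa_cst cA _)).
    exact: metric_continuous_at (hG.1 r Ir).
  exact: metric_continuous_at (hG.1 s Is).
pose U := (dom c `&` [set q | f q != 0])°.
have oU : open U by exact: open_interior.
have UZ : U `<=` Z.
  move=> q /interior_subset[cq /negP fq]; apply: subZ => /= H; apply: fq.
  by have /matrixP/(_ u v) := H c cq; rewrite !mxE /f => ->; rewrite subrr.
have : (0 < mu U)%E.
  apply: (riemannian_measure_gt0 hGh hmu oU); exists p.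
  apply: filterI; first by apply: open_nbhs_nbhs; split=> //; exact: dom_open.
  exact: (cf p cp _ (open_nbhs_nbhs (conj (@open_neq R 0) fp))).
rewrite ltNge => /negP; apply; rewrite -Z0; apply: le_measure => //.
  exact: mem_set (open_measurable_borel oU).
exact: mem_set.
Qed.

Variables Ma Mb : R.
Hypothesis hMa : relative_mass a b h Gh G mu r @[r --> nbhs_in a b a] --> Ma.
Hypothesis hMb : relative_mass a b h Gh G mu r @[r --> nbhs_in a b b] --> Mb.

(** The defect and the radial mass vanish identically in this case. *)
Lemma conformal_mass (Gt : tensor2 S) : is_riemannian_metric Gt ->
  same_family a b G (warped h Gt) -> Ma = 0 /\ Mb = 0.
Proof.
move=> gR GE.
have M0 r : I r -> relative_mass a b h Gh G mu r = 0.
  move=> Ir; rewrite /relative_mass /Rintegral.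
  rewrite (_ : (fun p => _) = cst 0%E) ?integral0//; apply/funext => p.
  have cp := dom_chart_at S p; congr EFin.
  rewrite (radial_massE h_smooth h_pos hG hGh Ir cp).
  rewrite (radial_shape_ext GE Ir cp) (warped_shape h_smooth h_pos gR Ir cp).
  by rewrite mxtrace_scalar subrr mulr0.
have lim0 r0 l : (a <= r0 <= b)%E ->
    relative_mass a b h Gh G mu r @[r --> nbhs_in a b r0] --> l -> l = 0.
  move=> r0ab /(near_nbhs_in ab M0) Hl.
  have PF := nbhs_in_proper ab r0ab.
  by apply: (cvg_unique _ Hl); [exact: Rhausdorff | exact: cvg_cst].
by split; [apply: lim0 hMa | apply: lim0 hMb]; rewrite lexx ltW.
Qed.

Hypothesis hL1 : (lebesgue_measure \x mu)%E.-integrable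
     [set z : R * g_sigma_algebraType (@open N) | (a < (z.1)%:E < b)%E]
     (EFin \o weighted_ricci_diff a b h Gh G).
Hypothesis hint : (0 <= \int[lebesgue_measure \x mu]_(z in
     [set z : R * g_sigma_algebraType (@open N) | a < (z.1)%:E < b])
     (weighted_ricci_diff a b h Gh G z)%:E)%E.

Let mu_fin : fin_num_fun mu.
Proof.
move=> A mA; rewrite ge0_fin_numE//.
apply: le_lt_trans (riemannian_measure_fin hGh hmu N_compact).
by apply: le_measure => //; exact: mem_set.
Qed.

Let muF : {finite_measure set (g_sigma_algebraType (@open N)) -> \bar R} :=
  finite_version mu_fin.

Let w t p := weighted_ricci_diff a b h Gh G (t, p).
Let m := radial_mass a b h Gh G.
Let q := defect_density h G.


Let m_deriv p t : I t -> is_derive t 1 (m ^~ p) (q t p + w t p).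
Proof. exact: is_derive_radial_mass. Qed.

Let q_ge0 p t : I t -> 0 <= q t p.
Proof. exact: defect_density_ge0. Qed.

Let q_cont p : continuous_on I (q ^~ p).
Proof. exact: defect_density_continuous. Qed.

Let w_cont p : continuous_on I (w ^~ p).
Proof. exact: weighted_ricci_continuous. Qed.

Let m_int t : I t -> muF.-integrable setT (EFin \o m t).
Proof.
move=> It; have mu_lty := riemannian_measure_fin hGh hmu N_compact.
exact: (continuous_integrable (mu := mu) N_compact mu_lty (radial_mass_continuous It)).
Qed.

Lemma mass_monotone : Ma <= Mb.
Proof.
have := @mass_le _ _ R muF a b m q w m_deriv q_ge0 q_cont w_cont m_int hL1 ab
  Ma Mb hMa hMb.
move=> H; rewrite -lee_fin; apply: le_trans H.
by rewrite leeDl.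
Qed.

Lemma mass_rigid : Mb = Ma ->
  exists2 Gt : tensor2 S, is_riemannian_metric Gt & same_family a b G (warped h Gt).
Proof.
move=> MbMa.
have conf r s c p : I r -> I s -> r < s -> dom c p ->
    h s ^+ 2 *: G r c p = h r ^+ 2 *: G s c p.
  move=> Ir Is rs cp; apply: dense_conformal (cp) => // {c p cp}.
  have := @mass_eq_defect _ _ R muF a b m q w m_deriv q_ge0 q_cont w_cont m_int hL1 ab
    Ma Mb hMa hMb r s Ir Is rs.
  case.
    by rewrite MbMa; rewrite leeDl.
  move=> Z [mZ Z0 subZ]; exists Z; split=> // p np; apply: subZ => /= q0; apply: np => c cp.
  exact: (no_defect_conformal h_smooth h_pos hG Ir Is rs cp q0).
have [r0 Ir0] := oitv_ex ab.
have hr0 : h r0 != 0 by rewrite gt_eqF// h_pos.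
exists (fun c p => (h r0 ^+ 2)^-1 *: G r0 c p).
  apply: metric_scale; last exact: hG.1.
  by rewrite invr_gt0 exprn_gt0// h_pos.
move=> t c p It cp; rewrite /warped scalerA.
have h2 : h r0 ^+ 2 != 0 by rewrite sqrf_eq0.
have : h r0 ^+ 2 *: G t c p = h t ^+ 2 *: G r0 c p.
  have [tr|rt|->//] := ltgtP t r0.
    exact: conf.
  by rewrite -conf.
by move=> /(congr1 (fun A => (h r0 ^+ 2)^-1 *: A)); rewrite !scalerA mulVf// scale1r mulrC.
Qed.

Lemma mass_eq_iff : Mb = Ma <->
  exists2 Gt : tensor2 S, is_riemannian_metric Gt & same_family a b G (warped h Gt).
Proof.
split; first exact: mass_rigid.
by move=> [Gt gR /(conformal_mass gR)[-> ->]].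
Qed.

(** The norm of G - G0 relative to G0 does not depend on r when both are warped by
    the same function, so it vanishes if it is small near r0. *)
Lemma asymptotic_same (Gt : tensor2 S) (r0 : \bar R) : is_riemannian_metric Gt ->
  same_family a b G (warped h Gt) -> (a <= r0 <= b)%E ->
  asymptotic_at a b G (warped h Gh) r0 -> forall c p, dom c p -> Gt c p = Gh c p.
Proof.
move=> gR GE r0ab asym.
suff main p (c := chart_at S p) : Gt c p = Gh c p.
  move=> c p cp; have c0p := dom_chart_at S p.
  by rewrite (metric_chart gR cp c0p) main -(metric_chart hGh cp c0p).
have cp : dom c p := dom_chart_at S p.
pose E := Gt c p - Gh c p.
have ET : E^T = E.
  by rewrite linearB /= (metric_sym gR cp) (metric_sym hGh cp).
pose tau := \tr (invmx (Gh c p) *m E *m (invmx (Gh c p) *m E)).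
have tauE r : I r -> tensor_norm (warped h Gh r)
    (fun c q => G r c q - warped h Gh r c q) p = Num.sqrt tau.
  move=> Ir; rewrite /tensor_norm -/c GE//; congr Num.sqrt.
  have h2 : h r ^+ 2 != 0 by rewrite sqrf_eq0 gt_eqF// h_pos.
  rewrite -/(warped h Gt r c p).
  have -> : warped h Gt r c p - warped h Gh r c p = h r ^+ 2 *: E.
    by rewrite /warped scalerBr.
  rewrite /warped invmxZ; last exact: (warped_unit h_pos hGh Ir cp).
  have -> : (h r ^+ 2 *: E)^T = h r ^+ 2 *: E by rewrite linearZ /= ET.
  have cancel k (A B : 'M[R]_d) : k != 0 -> (k^-1 *: A) *m (k *: B) = A *m B.
    by move=> k0; rewrite -scalemxAl -scalemxAr scalerA mulVf// scale1r.
  by rewrite -mulmxA !cancel.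
have tau0 : tau = 0.
  apply/eqP; rewrite eq_le mxtrace_sqr_ge0//; first last.
  - exact: metric_posdef hGh cp.
  - exact: metric_sym hGh cp.
  rewrite andbT leNgt; apply/negP => tau_gt0.
  have st : 0 < Num.sqrt tau by rewrite sqrtr_gt0.
  have [r Ir /(_ p)] := nbhs_in_ex ab r0ab (asym _ st).
  by rewrite tauE// ltxx.
apply/eqP; rewrite -subr_eq0; apply/eqP.
exact: mxtrace_sqr_eq0 (metric_sym hGh cp) (metric_posdef hGh cp) ET tau0.
Qed.

Lemma same_metric_family (G1 G2 : R -> tensor2 S) :
  same_metric a b G1 G2 <-> same_family a b G1 G2.
Proof.
split=> GE r c p Ir cp.
  have := GE r c p Ir cp; rewrite -!/(radial_pt _ _) !prod_metric_pt//.
  by move=> /eq_block_mx[].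
by rewrite -!/(radial_pt _ _) !prod_metric_pt// GE.
Qed.

End Rigidity.

Theorem corollary1p2 (R : realType) (n : nat) (hn : (2 <= n)%N)
  (N : ptopologicalType) (S : smooth_structure R n.-1 N)
  (hN_compact : compact [set: N]) (hN_hausdorff : hausdorff_space N)
  (a b : \bar R) (hab : (a < b)%E)
  (G : R -> tensor2 S) (hG : is_metric_family a b G)
  (h : R -> R) (h_smooth : smooth_on_itv a b h)
  (h_pos : forall r : R, (a < r%:E < b)%E -> 0 < h r)
  (Gh : tensor2 S) (hGh : is_riemannian_metric Gh)
  (mu : {measure set (g_sigma_algebraType (@open N)) -> \bar R})
  (hmu : is_riemannian_measure Gh mu)
  (Ma Mb : R)
  (hMa : relative_mass a b h Gh G mu r @[r --> nbhs_in a b a] --> Ma)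
  (hMb : relative_mass a b h Gh G mu r @[r --> nbhs_in a b b] --> Mb)
  (hL1 : (lebesgue_measure \x mu)%E.-integrable
     [set z : R * g_sigma_algebraType (@open N) | (a < (z.1)%:E < b)%E]
     (EFin \o weighted_ricci_diff a b h Gh G))
  (hint : (0 <= \int[lebesgue_measure \x mu]_(z in
     [set z : R * g_sigma_algebraType (@open N) | a < (z.1)%:E < b])
     (weighted_ricci_diff a b h Gh G z)%:E)%E) :
  [/\ Ma <= Mb,
      Mb = Ma <-> (exists2 Gt : tensor2 S, is_riemannian_metric Gt &
                     same_family a b G (warped h Gt))
    & (exists2 r0 : \bar R, (a <= r0 <= b)%E &
         asymptotic_at a b G (warped h Gh) r0) ->
      (Mb = Ma <-> same_metric a b G (warped h Gh))].
Proof.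
have eq_iff := mass_eq_iff hN_compact hab hG h_smooth h_pos hGh hmu hMa hMb hL1 hint.
split=> //.
  exact: (mass_monotone hN_compact hab hG h_smooth h_pos hGh hmu hMa hMb hL1 hint).
move=> [r0 r0ab asym]; rewrite eq_iff same_metric_family; split.
  move=> [Gt gR GE] r c p Ir cp; rewrite GE// /warped.
  by rewrite (asymptotic_same hab h_pos hGh gR GE r0ab asym cp).
by move=> GE; exists Gh.
Qed.
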